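(* Let $(V,\pi)$ and $(V',\pi')$ be two $\mathrm{Lod}_\infty$ algebras. A $\mathrm{Lod}_\infty$ morphism $f:(V,\pi)\to(V',\pi')$ is a sequence of weight $(1-p)e_1$ multilinear maps $f_p:V^{\times p}\to V'$, $p\ge1$, which satisfy, for all $p\ge1$ and all homogeneous $v_1,\ldots,v_p\in V$, the condition $$\sum_{s=1}^p\ \sum_{\substack{I^1\cup\ldots\cup I^s=N^{(p)}\\ I^1,\ldots,I^s\ne\emptyset\\ i^1_{|I^1|}<\ldots<i^s_{|I^s|}}}(-1)^{\omega}(-1)^{(I^1;\ldots;I^s)}\varepsilon_V(I^1;\ldots;I^s)\,\pi'_s\big(f_{|I^1|}(V_{I^1}),\ldots,f_{|I^s|}(V_{I^s})\big)$$ $$=\sum_{\substack{I\cup J\cup K=N^{(p)}\\ I,J<K}}(-1)^{\lambda}(-1)^{(J;I)}\varepsilon_V(I;J)\,f_{|I|+|K|}\big(V_I,\pi_{|J|+1}(V_J,v_{k_1}),V_{K\setminus k_1}\big),$$ where $$\omega=\frac{s(s-1)}{2}+\sum_{1\le r\le s}(s-r)|I^r|+\sum_{2\le r\le s}\langle(|I^r|+1)e_1,V_{I^1}+\ldots+V_{I^{r-1}}\rangle$$ and $\lambda=\langle(1+|J|)e_1,V_I+(p+1)e_1\rangle$. (Precisely: under the bijection $\mathcal{F}\mapsto(f_p)_{p\ge1}$, $f_p=\uparrow\circ\mathcal{F}_p\circ\downarrow^{\otimes p}$, between coalgebra cohomomorphisms $T(\downarrow V)\to T(\downarrow V')$ and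 sequences of weight $(1-p)e_1$ multilinear maps, $\mathcal{F}$ is a $\mathrm{Lod}_\infty$ morphism if and only if these conditions hold.)
   Context: Vector spaces are over a field $\mathbb{K}$ of characteristic $0$ and are $\mathbb{Z}^n$-graded; $\langle\alpha,\beta\rangle=\sum_i\alpha_i\beta_i$; a homogeneous vector or map and its degree/weight are denoted by the same symbol; $e_1=(1,0,\ldots,0)\in\mathbb{Z}^n$. Unshuffles. $N^{(p)}=(1,\ldots,p)$; an unshuffle $I=(i_1<\ldots<i_{|I|})$ is a naturally ordered (possibly empty) subset. In sums the unshuffles are pairwise disjoint with the given union. In sums over $I\cup J\cup K$ with $I,J<K$, $K=(k_1<k_2<\ldots)$ is nonempty and $I<K$ means $i_{|I|}<k_1$ (vacuous for empty $I$). $V_I$ denotes the tuple/tensor $(v_{i_1},\ldots,v_{i_{|I|}})$; in scalar products, $V_I$ stands for its total degree. $(-1)^{(I^1;\ldots;I^s)}$ is the signature of the permutation rearranging the concatenation $(I^1;\ldots;I^s)$ into increasing order, and $\varepsilon_V(I^1;\ldots;I^s)$ the corresponding Koszul sign; similarly for $(J;I)$ and $(I;J)$. Tensor coalgebra. For a graded space $W$, $T(W)=\bigoplus_{p\ge1}W^{\otimes p}$, $\mathbb{Z}^n$-graded by total degree, with coproduct $\Delta(w_1\otimes\ldots\otimes w_p)=\sum_{I\cup J=N^{(p-1)},\,I\ne\emptyset}\varepsilon_W(I;J)W_I\bigotimes W_J\otimes w_p$. Tensor products of maps: $(f\otimes g)(v_1\otimes v_2)=(-1)^{\langle g,v_1\rangle}f(v_1)\otimes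 g(v_2)$. A weight $Q$ coderivation is a weight $Q$ linear map with $\Delta Q=(Q\otimes\mathrm{id}+\mathrm{id}\otimes Q)\Delta$; a codifferential is a coderivation with $Q^2=0$. A coderivation is determined by its corestrictions $Q_p:W^{\otimes p}\hookrightarrow T(W)\xrightarrow{Q}T(W)\to W$ via $$Q(w_1\otimes\ldots\otimes w_p)=\sum_{I\cup J\cup K=N^{(p)},\;I,J<K}\varepsilon_W(I;J)(-1)^{\langle Q,W_I\rangle}W_I\otimes Q_{|J|+1}(W_J\otimes w_{k_1})\otimes W_{K\setminus k_1}.$$ A cohomomorphism $\mathcal{F}:(T(W),\Delta)\to(T(W'),\Delta)$ is a weight $0$ linear map with $\Delta\mathcal{F}=(\mathcal{F}\otimes\mathcal{F})\Delta$; it is uniquely determined by its corestrictions $\mathcal{F}_p:W^{\otimes p}\to W'$ (arbitrary weight $0$ maps) via $$\mathcal{F}(w_1\otimes\ldots\otimes w_p)=\sum_{s=1}^p\sum_{\substack{I^1\cup\ldots\cup I^s=N^{(p)},\ I^r\ne\emptyset\\ i^1_{|I^1|}<\ldots<i^s_{|I^s|}}}\varepsilon_W(I^1;\ldots;I^s)\mathcal{F}_{|I^1|}(W_{I^1})\otimes\ldots\otimes\mathcal{F}_{|I^s|}(W_{I^s}).$$ Desuspension. $\downarrow V$ is $V$ with grading $(\downarrow V)^\alpha=V^{\alpha+e_1}$; $\downarrow:V\to\downarrow V$ has weight $-e_1$ and inverse $\uparrow$; $\downarrow^{\otimes p}=\downarrow\otimes\ldots\otimes\downarrow$, i.e. $\downarrow^{\otimes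 p}(v_1\otimes\ldots\otimes v_p)=(-1)^{\sum_s(p-s)\langle e_1,v_s\rangle}\downarrow v_1\otimes\ldots\otimes\downarrow v_p$. A $\mathrm{Lod}_\infty$ algebra is a graded space $V$ with a codifferential $Q$ of weight $e_1$ on $(T(\downarrow V),\Delta)$, represented by the sequence $\pi=(\pi_1,\pi_2,\ldots)$ of multilinear maps $\pi_p=\uparrow\circ Q_p\circ\downarrow^{\otimes p}:V^{\times p}\to V$ of weight $(2-p)e_1$. A $\mathrm{Lod}_\infty$ morphism from $(V,Q)$ to $(V',Q')$ is a cohomomorphism $\mathcal{F}:T(\downarrow V)\to T(\downarrow V')$ with $Q'\mathcal{F}=\mathcal{F}Q$. *)

(* Defs.v *)
From HB Require Import structures.
From mathcomp Require Import all_boot all_order all_algebra.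
From mathcomp Require Import generic_quotient.
From mathcomp Require Import mathcomp_extra boolp classical_sets functions.
From mathcomp Require Import cardinality fsbigop.

Set Implicit Arguments.
Unset Strict Implicit.
Unset Printing Implicit Defensive.

Import GRing.Theory.
Local Open Scope classical_set_scope.
Local Open Scope ring_scope.
Local Open Scope quotient_scope.

(** [univ adm] is the vector space of formal linear combinations of elements
    of [X], two combinations being identified when every admissible map from
    [X] to a vector space gives them the same value.  For the bilinear maps on
    [U * V] this is the tensor product of [U] and [V]; for the families of
    multilinear maps on words it is the reduced tensor algebra. *)
Section Univ.
Variables (K : fieldType) (X : choiceType).
Variable adm : forall M : lmodType K, (X -> M) -> Prop.

Definition feval (M : lmodType K) (f : X -> M) (s : seq (K * X)) : M :=
  \sum_(x <- s) x.1 *: f x.2.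

Definition usim : rel (seq (K * X)) := fun s t =>
  `[< forall (M : lmodType K) (f : X -> M), adm f -> feval f s = feval f t >].

Lemma usim_equiv : equiv_class_of usim.
Proof.
split=> [s|s t|t s u].
- by apply/asboolP.
- by apply/asboolP/asboolP => h M f fa; rewrite h.
- by move=> /asboolP h1 /asboolP h2; apply/asboolP => M f fa; rewrite h1 ?h2.
Qed.
Canonical usim_equiv_rel := EquivRelPack usim_equiv.

Definition univ := {eq_quot usim}.
HB.instance Definition _ := Choice.on univ.

Definition ulift (M : lmodType K) (f : X -> M) (q : univ) : M :=
  feval f (repr q).

Definition ugen (x : X) : univ := \pi_univ [:: (1, x)].

Definition uscale (c : K) (q : univ) : univ :=
  \pi_univ [seq (c * x.1, x.2) | x <- repr q].
Definition uadd (q r : univ) : univ := \pi_univ (repr q ++ repr r).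

Lemma ulift_pi (M : lmodType K) (f : X -> M) s :
  adm f -> ulift f (\pi_univ s) = feval f s.
Proof.
move=> fa; rewrite /ulift; case: piP => t /eqmodP.
by move=> /asboolP h; rewrite h.
Qed.

Lemma univP (q r : univ) :
  (forall (M : lmodType K) (f : X -> M), adm f -> ulift f q = ulift f r) ->
  q = r.
Proof.
move=> h; rewrite -[q]reprK -[r]reprK; apply/eqmodP/asboolP => M f fa.
exact: (h M f fa).
Qed.

Lemma feval_cat (M : lmodType K) (f : X -> M) s t :
  feval f (s ++ t) = feval f s + feval f t.
Proof. by rewrite /feval big_cat. Qed.

Lemma feval_scale (M : lmodType K) (f : X -> M) c s :
  feval f [seq (c * x.1, x.2) | x <- s] = c *: feval f s.
Proof.
rewrite /feval big_map scaler_sumr; apply: eq_bigr => x _ /=.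
by rewrite scalerA.
Qed.

Lemma ulift_add (M : lmodType K) (f : X -> M) q r :
  adm f -> ulift f (uadd q r) = ulift f q + ulift f r.
Proof. by move=> fa; rewrite ulift_pi // feval_cat. Qed.

Lemma ulift_scale (M : lmodType K) (f : X -> M) c q :
  adm f -> ulift f (uscale c q) = c *: ulift f q.
Proof. by move=> fa; rewrite ulift_pi // feval_scale. Qed.

Lemma ulift_zero (M : lmodType K) (f : X -> M) :
  adm f -> ulift f (\pi_univ [::]) = 0.
Proof. by move=> fa; rewrite ulift_pi // /feval big_nil. Qed.

Let ulE := (ulift_add, ulift_scale, ulift_zero).

Lemma uaddA : associative uadd.
Proof. by move=> x y z; apply: univP => M f fa; rewrite !ulE // addrA. Qed.
Lemma uaddC : commutative uadd.
Proof. by move=> x y; apply: univP => M f fa; rewrite !ulE // addrC. Qed.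
Lemma uadd0 : left_id (\pi_univ [::]) uadd.
Proof. by move=> x; apply: univP => M f fa; rewrite !ulE // add0r. Qed.
Lemma uaddN : left_inverse (\pi_univ [::]) (uscale (-1)) uadd.
Proof.
by move=> x; apply: univP => M f fa; rewrite !ulE // scaleN1r addNr.
Qed.

HB.instance Definition _ := GRing.isZmodule.Build univ uaddA uaddC uadd0 uaddN.

Lemma uscaleA a b q : uscale a (uscale b q) = uscale (a * b) q.
Proof. by apply: univP => M f fa; rewrite !ulE // scalerA. Qed.
Lemma uscale1 : left_id 1 uscale.
Proof. by move=> q; apply: univP => M f fa; rewrite !ulE // scale1r. Qed.
Lemma uscaleDr : right_distributive uscale +%R.
Proof.
by move=> c x y; apply: univP => M f fa; rewrite !ulE // scalerDr.
Qed.
Lemma uscaleDl q : {morph uscale^~ q : a b / a + b}.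
Proof.
by move=> a b; apply: univP => M f fa; rewrite !ulE // scalerDl.
Qed.

HB.instance Definition _ :=
  GRing.Zmodule_isLmodule.Build K univ uscaleA uscale1 uscaleDr uscaleDl.

Lemma ulift_linear (M : lmodType K) (f : X -> M) : adm f -> linear (ulift f).
Proof. by move=> fa c x y; rewrite ulift_add // ulift_scale. Qed.

Lemma ulift_gen (M : lmodType K) (f : X -> M) x :
  adm f -> ulift f (ugen x) = f x.
Proof. by move=> fa; rewrite ulift_pi // /feval big_seq1 scale1r. Qed.

Lemma univ_ind (P : univ -> Prop) :
  P 0 -> (forall c x y, P x -> P y -> P (c *: x + y)) ->
  (forall x, P (ugen x)) -> forall q, P q.
Proof.
move=> P0 Plin Pgen q; rewrite -[q]reprK; elim: (repr q) => [//|[c x] s IHs].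
rewrite (_ : \pi_univ _ = c *: ugen x + \pi_univ s); first exact: Plin.
apply: univP => M f fa; rewrite ulift_linear // ulift_gen //.
by rewrite !ulift_pi // /feval big_cons.
Qed.

End Univ.

Section Tensor.
Variables (K : fieldType) (U V : lmodType K).

Definition bilinear_map (M : lmodType K) (f : U * V -> M) : Prop :=
  (forall v, linear (fun u => f (u, v))) /\
  (forall u, linear (fun v => f (u, v))).

Definition tensor := univ bilinear_map.
HB.instance Definition _ := GRing.Lmodule.on tensor.

Definition tens2 (u : U) (v : V) : tensor := ugen bilinear_map (u, v).

Lemma tens2_bilinear : bilinear_map (fun uv => tens2 uv.1 uv.2).
Proof.
split=> [v|u] c x y; apply: univP => M f fa.
  by rewrite ulift_linear // !ulift_gen //= fa.1.
by rewrite ulift_linear // !ulift_gen //= fa.2.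
Qed.

End Tensor.
Notation "u \ox v" := (tens2 u v) (at level 40, left associativity).

(** A family of multilinear maps [f_p] on p-tuples, p >= 1, is represented by
    one function on lists, [f_p] being its restriction to the lists of length
    [p]; since there is no [f_0], the value on the empty list is fixed to 0. *)
Section Words.
Variables (K : fieldType) (U : lmodType K).

Definition multilinear (M : lmodType K) (f : seq U -> M) : Prop :=
  f [::] = 0 /\
  forall s1 s2 c u v, f (s1 ++ (c *: u + v) :: s2) =
    c *: f (s1 ++ u :: s2) + f (s1 ++ v :: s2).

(* The direct sum of the tensor powers of [U] of positive exponent. *)
Definition tpowers := univ multilinear.
HB.instance Definition _ := GRing.Lmodule.on tpowers.

Definition tens (w : seq U) : tpowers := ugen multilinear w.

Lemma tens_multilinear : multilinear tens.
Proof.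
split=> [|s1 s2 c u v]; apply: univP => M f fa.
  by rewrite ulift_gen // fa.1 ulift_zero.
by rewrite ulift_linear // !ulift_gen // fa.2.
Qed.

Definition corestr (x : tpowers) : U :=
  ulift (fun w => if w is [:: u] then u else 0) x.

Lemma corestr_multilinear :
  multilinear (fun w : seq U => if w is [:: u] then u else 0).
Proof.
split=> // -[|x [|y s1]] [|z s2] c u v //=; by rewrite scaler0 addr0.
Qed.

End Words.

(* The grading group is Z^n.+1, so that e_1 makes sense. *)
Notation deg n := 'rV[int]_n.+1.

Definition dot n (a b : deg n) : int := \sum_(i < n.+1) a 0 i * b 0 i.

Definition e1 {n} : deg n := delta_mx 0 0.

(* A decomposition of the vector space [gsort] as the direct sum of subspaces
   indexed by Z^n.+1, given by the projections [gproj a] onto its summands: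
   every vector is the finite sum of its homogeneous components. *)
Record gspace (K : fieldType) (n : nat) := GSpace {
  gsort :> lmodType K;
  gproj : deg n -> gsort -> gsort;
  gproj_linear : forall a, linear (gproj a);
  gproj_proj : forall a b v,
    gproj a (gproj b v) = if a == b then gproj b v else 0;
  gproj_finite : forall v, finite_set [set a | gproj a v != 0];
  gproj_sum : forall v, \sum_(a \in [set: deg n]) gproj a v = v }.
Arguments gproj {K n} g a v.

Section FSum.
Variables (I : choiceType) (K : fieldType) (M : lmodType K).

Lemma fsumE (s : seq I) (F : I -> M) : uniq s ->
  (forall i, i \notin s -> F i = 0) ->
  \sum_(i \in [set: I]) F i = \sum_(i <- s) F i.
Proof.
move=> us h; rewrite [RHS]fsbig_seq //; apply: esym; apply: fsbig_widen => //.
by move=> i [_ /= /negP]; exact: h.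
Qed.

Lemma finite_cover (F : I -> M) : finite_set [set i | F i != 0] ->
  exists2 s, uniq s & forall i, i \notin s -> F i = 0.
Proof.
move=> /finite_seqP [s sE]; exists (undup s); first exact: undup_uniq.
move=> i; rewrite mem_undup => ins; apply/eqP/negPn/negP => Fi.
have : [set j | F j != 0] i by [].
by rewrite sE /= (negbTE ins).
Qed.

Lemma cover_finite (s : seq I) (F : I -> M) :
  (forall i, i \notin s -> F i = 0) -> finite_set [set i | F i != 0].
Proof.
move=> h; apply: (sub_finite_set _ (finite_seq s)) => i /= Fi.
by apply/negPn/negP => /h; apply/eqP.
Qed.

Lemma fsum_linear (F G : I -> M) (c : K) :
  finite_set [set i | F i != 0] -> finite_set [set i | G i != 0] ->
  \sum_(i \in [set: I]) (c *: F i + G i) =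
    c *: (\sum_(i \in [set: I]) F i) + \sum_(i \in [set: I]) G i.
Proof.
move=> /finite_cover[s us hs] /finite_cover[t ut ht].
have u : uniq (undup (s ++ t)) by exact: undup_uniq.
have notin i : i \notin undup (s ++ t) -> F i = 0 /\ G i = 0.
  rewrite mem_undup mem_cat negb_or => /andP[si ti].
  by rewrite hs ?ht.
have hF i : i \notin undup (s ++ t) -> F i = 0 by move/notin => [].
have hG i : i \notin undup (s ++ t) -> G i = 0 by move/notin => [].
rewrite (fsumE u hF) (fsumE u hG) (fsumE u) ?big_split ?scaler_sumr // => i ni.
by rewrite hF ?hG // scaler0 addr0.
Qed.

End FSum.

Section GSpaceTheory.
Variables (K : fieldType) (n : nat).

Definition ghom (V : gspace K n) (a : deg n) (v : V) : Prop := gproj V a v = v.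

Definition has_weight (V W : gspace K n) (b : deg n) (f : V -> W) : Prop :=
  forall a v, ghom a v -> ghom (a + b) (f v).

Definition dsign (a b : deg n) : K := (-1) ^ dot a b.

(* The linear map v |-> (-1)^<b,v> v, v homogeneous. *)
Definition ksign (V : gspace K n) (b : deg n) (v : V) : V :=
  \sum_(a \in [set: deg n]) dsign b a *: gproj V a v.

(* The tensor product f (x) g of linear maps, for g of weight b:
   u (x) v |-> (-1)^<b,u> f u (x) g v, u homogeneous. *)
Definition tensor_map (V W V' W' : gspace K n) (f : V -> V') (b : deg n)
    (g : W -> W') (x : tensor V W) : tensor V' W' :=
  ulift (fun vw => f (ksign b vw.1) \ox g vw.2) x.

Lemma gproj0 (V : gspace K n) a : gproj V a 0 = 0.
Proof.
have := gproj_linear (g := V) a (-1) 0 0.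
by rewrite scaler0 addr0 scaleN1r addNr.
Qed.

Lemma ksign_hom (V : gspace K n) b a (v : V) :
  ghom a v -> ksign b v = dsign b a *: v.
Proof.
move=> hv; rewrite /ksign (fsumE (s := [:: a])) ?big_seq1 ?hv // => c.
by rewrite inE -hv gproj_proj => /negbTE ->; rewrite scaler0.
Qed.

Lemma ksign_linear (V : gspace K n) b : linear (@ksign V b).
Proof.
move=> c u v; rewrite /ksign -fsum_linear.
- apply: eq_fsbigr => a _; rewrite gproj_linear scalerDr !scalerA.
  by rewrite [c * _]mulrC.
- have [s us hs] := finite_cover (gproj_finite u).
  by apply: (cover_finite (s := s)) => a /hs ->; rewrite scaler0.
- have [s us hs] := finite_cover (gproj_finite v).
  by apply: (cover_finite (s := s)) => a /hs ->; rewrite scaler0.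
Qed.

(** A word of homogeneous vectors together with their degrees is a list of
    pairs (degree, vector).  A function [phi] on such words, linear in each
    vector, extends to arbitrary words by decomposing each letter into its
    homogeneous components. *)
Section HomExt.
Variables (W : gspace K n) (M : lmodType K).
Implicit Type phi : seq (deg n * W) -> M.

Fixpoint homext phi (w : seq W) : M :=
  if w is v :: w' then
    \sum_(a \in [set: deg n]) homext (fun l => phi ((a, gproj W a v) :: l)) w'
  else phi [::].

Definition slotlinear phi : Prop := forall l1 l2 a c u v,
  phi (l1 ++ (a, c *: u + v) :: l2) =
    c *: phi (l1 ++ (a, u) :: l2) + phi (l1 ++ (a, v) :: l2).

Lemma slotlinear0 phi l1 l2 a :
  slotlinear phi -> phi (l1 ++ (a, 0) :: l2) = 0.
Proof.
move=> h; have := h l1 l2 a (-1) 0 0.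
by rewrite scaler0 addr0 scaleN1r addNr.
Qed.

Lemma slotlinear_cons phi x :
  slotlinear phi -> slotlinear (fun l => phi (x :: l)).
Proof. by move=> h l1 l2 a c u v; exact: (h (x :: l1)). Qed.

Lemma homext_eq0 phi w : phi =1 (fun=> 0) -> homext phi w = 0.
Proof.
elim: w phi => [|v w IH] phi h /=; first exact: h.
by apply: fsbig1 => a _; apply: IH => l; exact: h.
Qed.

Lemma homext_finite phi v w : slotlinear phi -> finite_set
  [set a | homext (fun l => phi ((a, gproj W a v) :: l)) w != 0].
Proof.
move=> h; have [s _ hs] := finite_cover (gproj_finite v).
apply: (cover_finite (s := s)) => a /hs ->; apply: homext_eq0 => l.
exact: (slotlinear0 [::]).
Qed.

Lemma homext_linear phi phi1 phi2 c w :
  slotlinear phi1 -> slotlinear phi2 ->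
  (forall l, phi l = c *: phi1 l + phi2 l) ->
  homext phi w = c *: homext phi1 w + homext phi2 w.
Proof.
elim: w phi phi1 phi2 => [|v w IH] phi phi1 phi2 h1 h2 h /=; first exact: h.
rewrite -fsum_linear; [|exact: homext_finite..].
by apply: eq_fsbigr => a _; apply: IH => //; exact: slotlinear_cons.
Qed.

Lemma homext_multilinear phi :
  slotlinear phi -> phi [::] = 0 -> multilinear (homext phi).
Proof.
move=> h h0; split=> // s1 s2 c u v.
elim: s1 phi h {h0} => [|x s1 IH] phi h /=.
  rewrite -fsum_linear; [|exact: homext_finite..].
  apply: eq_fsbigr => a _; apply: homext_linear; try exact: slotlinear_cons.
  by move=> l; rewrite gproj_linear (h [::]).
rewrite -fsum_linear; [|exact: homext_finite..].
by apply: eq_fsbigr => a _; apply: IH; exact: slotlinear_cons.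
Qed.

Lemma homext_hom phi (l : seq (deg n * W)) : slotlinear phi ->
  (forall x, x \in l -> ghom x.1 x.2) -> homext phi [seq x.2 | x <- l] = phi l.
Proof.
elim: l phi => [//|[a v] l IH] phi h hl /=.
have hv : ghom a v by apply: (hl (a, v)); rewrite inE eqxx.
rewrite (fsumE (s := [:: a])) // ?big_seq1; last first.
  move=> b; rewrite inE -hv gproj_proj => /negbTE ->.
  apply: homext_eq0 => l'; exact: (slotlinear0 [::]).
rewrite hv IH //; first exact: slotlinear_cons.
by move=> x xl; apply: hl; rewrite inE xl orbT.
Qed.

End HomExt.

Definition homlist (W : gspace K n) (l : seq (deg n * W)) : Prop :=
  forall x, x \in l -> ghom x.1 x.2.

Lemma tpowers_homind (W : gspace K n) (P : tpowers W -> Prop) :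
  P 0 -> (forall c x y, P x -> P y -> P (c *: x + y)) ->
  (forall l : seq (deg n * W), homlist l -> P (tens [seq x.2 | x <- l])) ->
  forall x, P x.
Proof.
move=> P0 Plin Phom.
suff h w (l : seq (deg n * W)) : homlist l ->
    P (tens ([seq x.2 | x <- l] ++ w)).
  by apply: univ_ind => // w; exact: (h w [::]).
elim: w l => [|v w IH] l hl; first by rewrite cats0; exact: Phom.
rewrite -[v]gproj_sum.
have [s us hs] := finite_cover (gproj_finite v).
rewrite (fsumE us) //.
elim: s {us hs} => [|a s IHs].
  rewrite big_nil; have := (tens_multilinear W).2 (map snd l) w (-1) 0 0.
  by rewrite scaler0 addr0 scaleN1r addNr => ->.
rewrite big_cons -[gproj W a v]scale1r (tens_multilinear W).2.
apply: Plin => //; have := IH (rcons l (a, gproj W a v)).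
rewrite map_rcons cat_rcons; apply => x; rewrite mem_rcons inE.
by case/orP => [/eqP ->|/hl//]; rewrite /ghom /= gproj_proj eqxx.
Qed.

Section TotalGrading.
Variable W : gspace K n.

Definition tproj_word (g : deg n) (l : seq (deg n * W)) : tpowers W :=
  if \sum_(x <- l) x.1 == g then tens [seq x.2 | x <- l] else 0.

Definition tproj (g : deg n) (x : tpowers W) : tpowers W :=
  ulift (homext (tproj_word g)) x.

Lemma tproj_word_multilinear g : multilinear (homext (tproj_word g)).
Proof.
apply: homext_multilinear.
  move=> l1 l2 a c u v; rewrite /tproj_word !big_cat !big_cons !map_cat /=.
  case: ifP => _; first exact: (tens_multilinear W).2.
  by rewrite scaler0 addr0.
by rewrite /tproj_word /= (tens_multilinear W).1 if_same.
Qed.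

Lemma tproj_linear g : linear (tproj g).
Proof. exact: ulift_linear (tproj_word_multilinear g). Qed.

Lemma tproj_hom g (l : seq (deg n * W)) : homlist l ->
  tproj g (tens [seq x.2 | x <- l]) = tproj_word g l.
Proof.
move=> hl; rewrite /tproj ulift_gen; last exact: tproj_word_multilinear.
apply: homext_hom => // l1 l2 a c u v.
rewrite /tproj_word !big_cat !big_cons !map_cat /=.
case: ifP => _; first exact: (tens_multilinear W).2.
by rewrite scaler0 addr0.
Qed.

Lemma tproj0 g : tproj g 0 = 0.
Proof.
by have := tproj_linear g (-1) 0 0; rewrite scaler0 addr0 scaleN1r addNr.
Qed.

Lemma tproj_proj a b x :
  tproj a (tproj b x) = if a == b then tproj b x else 0.
Proof.
elim/tpowers_homind: x => [|c x y hx hy|l hl].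
- by rewrite !tproj0 if_same.
- by rewrite !tproj_linear hx hy; case: ifP; rewrite // scaler0 addr0.
- rewrite tproj_hom // /tproj_word; case: eqP => [<-|_]; last first.
    by rewrite tproj0 if_same.
  by rewrite tproj_hom // /tproj_word eq_sym.
Qed.

Lemma tproj_finite x : finite_set [set a | tproj a x != 0].
Proof.
suff: exists s : seq (deg n), forall a, a \notin s -> tproj a x = 0.
  by case=> s hs; exact: (cover_finite (F := fun a => tproj a x) hs).
move: x; apply: tpowers_homind => [|c x y [s hs] [t ht]|l hl].
- by exists [::] => a _; exact: tproj0.
- exists (s ++ t) => a; rewrite mem_cat negb_or => /andP[/hs sa /ht ta].
  by rewrite tproj_linear sa ta scaler0 addr0.
- exists [:: \sum_(x <- l) x.1] => a; rewrite inE tproj_hom // eq_sym.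
  by rewrite /tproj_word => /negbTE ->.
Qed.

Lemma tproj_sum x : \sum_(a \in [set: deg n]) tproj a x = x.
Proof.
elim/tpowers_homind: x => [|c x y hx hy|l hl].
- by apply: fsbig1 => a _; exact: tproj0.
- rewrite -[in RHS]hx -[in RHS]hy -fsum_linear; try exact: tproj_finite.
  by apply: eq_fsbigr => a _; rewrite tproj_linear.
- rewrite (fsumE (s := [:: \sum_(x <- l) x.1])) // ?big_seq1.
    by rewrite tproj_hom // /tproj_word eqxx.
  by move=> a; rewrite inE tproj_hom // /tproj_word eq_sym => /negbTE ->.
Qed.

Definition tspace : gspace K n :=
  GSpace tproj_linear tproj_proj tproj_finite tproj_sum.

End TotalGrading.
End GSpaceTheory.

(** Indices run over ['I_p = {0, ..., p-1}] and an unshuffle is a subset of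
    ['I_p], listed in increasing order by [enum]. *)
Section Signs.
Variables (p : nat).

Definition select (U : Type) (v : 'I_p -> U) (I : {set 'I_p}) : seq U :=
  [seq v i | i <- enum I].

Fixpoint inversions (s : seq 'I_p) : seq ('I_p * 'I_p) :=
  if s is i :: s' then
    [seq (i, j) | j : 'I_p <- s' & (j < i)%N] ++ inversions s'
  else [::].

(* Signature of the permutation sorting [s]. *)
Definition signature (K : fieldType) (s : seq 'I_p) : K :=
  (-1) ^+ size (inversions s).

(* Koszul sign of the permutation sorting [s], for vectors of degrees [d]. *)
Definition koszul (K : fieldType) n (d : 'I_p -> deg n) (s : seq 'I_p) : K :=
  \prod_(x <- inversions s) dsign K (d x.1) (d x.2).

End Signs.
Arguments signature {p} K s.
Arguments koszul {p} K {n} d s.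

Section Coalgebra.
Variables (K : fieldType) (n : nat).

(* The coproduct on homogeneous words w_1 ... w_m w_p, m = p - 1 being the
   index of the last letter; J is the complement of I in {0, ..., m-1}. *)
Definition coprod_word (W : gspace K n) (l : seq (deg n * W)) :
    tensor (tspace W) (tspace W) :=
  let m := (size l).-1 in
  let w (i : 'I_m) := (l`_i).2 in
  \sum_(I : {set 'I_m} | I != finset.set0)
    koszul K (fun i : 'I_m => (l`_i).1) (enum I ++ enum (~: I)) *:
    ((tens (select w I) : tspace W) \ox
     (tens (rcons (select w (~: I)) (l`_m).2) : tspace W)).

Definition coprod (W : gspace K n) (x : tspace W) :
    tensor (tspace W) (tspace W) :=
  ulift (homext (@coprod_word W)) x.

Section Multilinearity.
Variables (W : gspace K n) (l1 l2 : seq (deg n * W)) (a : deg n).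

Let L (z : W) := l1 ++ (a, z) :: l2.
Let k := size l1.
Let sel z (r : seq nat) := [seq ((L z)`_i).2 | i <- r].

Let nth_L z i : (L z)`_i = if i == k then (a, z) else (L 0)`_i.
Proof.
rewrite /L !nth_cat -/k; case: ltngtP => // [h|->]; last by rewrite subnn.
by case: (i - k)%N (subn_gt0 k i) => [|j] //=; rewrite h.
Qed.

Let sel_notin z r : k \notin r -> sel z r = sel 0 r.
Proof.
move=> kr; apply/eq_in_map => i ir; rewrite nth_L; case: eqP => // ik.
by rewrite -ik ir in kr.
Qed.

Let sel_in c u v r : uniq r -> k \in r ->
  tens (sel (c *: u + v) r) = c *: tens (sel u r) + tens (sel v r).
Proof.
move=> ur kr; case/splitPr: kr ur => r1 r2.
rewrite cat_uniq /= => /and3P[_ /norP[kr1 _] /andP[kr2 _]].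
have E z : sel z (r1 ++ k :: r2) = sel 0 r1 ++ z :: sel 0 r2.
  by rewrite -(sel_notin z kr1) -(sel_notin z kr2) /sel map_cat /= nth_L eqxx.
by rewrite !E (tens_multilinear W).2.
Qed.

Lemma coprod_word_slot c u v :
  coprod_word (L (c *: u + v)) =
    c *: coprod_word (L u) + coprod_word (L v).
Proof.
have sz z : (size (L z)).-1 = (size l1 + size l2)%N.
  by rewrite size_cat /= addnS.
rewrite /coprod_word !{}sz; set m := (size l1 + size l2)%N.
have km : (k <= m)%N by exact: leq_addr.
rewrite scaler_sumr -big_split; apply: eq_bigr => I _ /=.
have kE z z' : koszul K (fun i : 'I_m => ((L z)`_i).1) =
               koszul K (fun i : 'I_m => ((L z')`_i).1).
  by congr koszul; apply/funext => i; rewrite (nth_L z) (nth_L z'); case: ifP.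
rewrite (kE (c *: u + v) 0) (kE u 0) (kE v 0); set e := koszul _ _ _.
pose r1 := map val (enum I); pose r2 := rcons (map val (enum (~: I))) m.
have E1 z : select (fun i : 'I_m => ((L z)`_i).2) I = sel z r1.
  by rewrite /sel /r1 -map_comp.
have E2 z : rcons (select (fun i : 'I_m => ((L z)`_i).2) (~: I)) ((L z)`_m).2
    = sel z r2.
  by rewrite /sel /r2 map_rcons -map_comp.
rewrite !E1 !E2.
have u1 : uniq r1 by rewrite map_inj_uniq ?enum_uniq //; exact: val_inj.
have u2 : uniq r2.
  rewrite rcons_uniq map_inj_uniq ?enum_uniq ?andbT; last exact: val_inj.
  by apply/mapP => -[i _ mi]; have := ltn_ord i; rewrite -mi ltnn.
have kr : (k \in r1) = (k \notin r2).
  rewrite mem_rcons inE negb_or; have [->|kneq] /= := eqVneq k m.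
    by apply/mapP => -[i _ mi]; have := ltn_ord i; rewrite -mi ltnn.
  have ltkm : (k < m)%N by rewrite ltn_neqAle kneq.
  have E (A : {set 'I_m}) : (k \in map val (enum A)) = (Ordinal ltkm \in A).
    by rewrite -(mem_enum A) -(mem_map val_inj (enum A)).
  by rewrite !E finset.in_setC negbK.
have tb := tens2_bilinear (tspace W) (tspace W).
case k1 : (k \in r1).
  have k2 : k \notin r2 by rewrite -kr.
  rewrite (sel_notin (_ + _) k2) (sel_notin u k2) (sel_notin v k2) sel_in //.
  have := tb.1 (tens (sel 0 r2)) c (tens (sel u r1)) (tens (sel v r1)).
  by move=> /= ->; rewrite scalerDr !scalerA mulrC.
have k2 : k \in r2 by rewrite -[_ \in _]negbK -kr k1.
have {}k1 := negbT k1.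
rewrite (sel_notin (_ + _) k1) (sel_notin u k1) (sel_notin v k1) sel_in //.
have := tb.2 (tens (sel 0 r1)) c (tens (sel u r2)) (tens (sel v r2)).
by move=> /= ->; rewrite scalerDr !scalerA mulrC.
Qed.
End Multilinearity.

Lemma coprod_word_nil (W : gspace K n) : coprod_word ([::] : seq (deg n * W)) = 0.
Proof.
rewrite /coprod_word /= big1 // => I /finset.set0Pn[[]].
by [].
Qed.

Lemma coprod_word_multilinear (W : gspace K n) :
  multilinear (homext (@coprod_word W)).
Proof.
apply: homext_multilinear; last exact: coprod_word_nil.
exact: coprod_word_slot.
Qed.

Lemma coprod_linear (W : gspace K n) : linear (@coprod W).
Proof. exact: ulift_linear (coprod_word_multilinear W). Qed.

Lemma coprod_hom (W : gspace K n) (l : seq (deg n * W)) : homlist l ->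
  coprod (tens [seq x.2 | x <- l]) = coprod_word l.
Proof.
move=> hl; rewrite /coprod ulift_gen; last exact: coprod_word_multilinear.
by apply: homext_hom => //; exact: coprod_word_slot.
Qed.

Definition coderivation (W : gspace K n) (b : deg n) (Q : tspace W -> tspace W)
    : Prop :=
  [/\ linear Q, has_weight b Q &
   forall x, coprod (Q x) =
     tensor_map Q 0 id (coprod x) + tensor_map id b Q (coprod x)].

Definition codifferential (W : gspace K n) (b : deg n)
    (Q : tspace W -> tspace W) : Prop :=
  coderivation b Q /\ forall x, Q (Q x) = 0.

Definition cohomomorphism (W W' : gspace K n) (F : tspace W -> tspace W')
    : Prop :=
  [/\ linear F, has_weight 0 F &
   forall x, coprod (F x) = tensor_map F 0 F (coprod x)].

End Coalgebra.

Section LodInfty.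
Variables (K : fieldType) (n : nat).

Section Desuspension.
Variable V : gspace K n.

Lemma desusp_proj (a b : deg n) (v : V) :
  gproj V (a + e1) (gproj V (b + e1) v) =
  if a == b then gproj V (b + e1) v else 0.
Proof. by rewrite gproj_proj (inj_eq (addIr e1)). Qed.

Lemma desusp_sum (v : V) : \sum_(a \in [set: deg n]) gproj V (a + e1) v = v.
Proof.
rewrite -[RHS]gproj_sum [RHS](reindex_fsbigT (fun a => a + e1)) //.
by exists (fun a => a - e1) => a; rewrite ?addrK ?subrK.
Qed.

Lemma desusp_finite (v : V) : finite_set [set a | gproj V (a + e1) v != 0].
Proof.
have [s _ hs] := finite_cover (gproj_finite v).
apply: (cover_finite (s := [seq a - e1 | a <- s])) => a ha; apply: hs.
apply: contra ha => as_; apply/mapP; exists (a + e1) => //.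
by rewrite addrK.
Qed.

(* The vector space V with the degree a component V^(a + e_1). *)
Definition desusp : gspace K n :=
  @GSpace K n V (fun a => gproj V (a + e1))
    (fun a => gproj_linear (g := V) (a + e1))
    desusp_proj desusp_finite desusp_sum.

Definition down (v : V) : desusp := v.
Definition up (v : desusp) : V := v.

(* The p-th tensor power of [down], p = size w: the s-th letter (s = i + 1)
   contributes the sign (-1)^((p-s)<e_1,w_s>). *)
Definition down_tensor (w : seq V) : tspace desusp :=
  tens [seq down (ksign (e1 *+ (size w - i.+1)) w`_i) | i <- iota 0 (size w)].

End Desuspension.

(* The maps up o F_p o down^(x)p, for F_p the corestrictions of F.  They give
   both the structure maps pi_p of a codifferential and the components f_p of
   a cohomomorphism. *)
Definition components (V V' : gspace K n)
    (F : tspace (desusp V) -> tspace (desusp V')) (w : seq V) : V' :=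
  up (corestr (F (down_tensor w))).

(* Sequences of weight (1-p) e_1 multilinear maps f_p, p >= 1. *)
Definition component_sequence (V V' : gspace K n) (f : seq V -> V') : Prop :=
  multilinear f /\
  forall p (a : 'I_p -> deg n) (v : 'I_p -> V), (0 < p)%N ->
    (forall i, ghom (a i) (v i)) ->
    ghom (\sum_i a i + e1 *~ (1 - p%:Z)) (f [seq v i | i <- enum 'I_p]).

Definition lod_infty_algebra (V : gspace K n)
    (Q : tspace (desusp V) -> tspace (desusp V)) : Prop :=
  codifferential e1 Q.

Definition lod_infty_morphism (V V' : gspace K n)
    (Q : tspace (desusp V) -> tspace (desusp V))
    (Q' : tspace (desusp V') -> tspace (desusp V'))
    (F : tspace (desusp V) -> tspace (desusp V')) : Prop :=
  cohomomorphism F /\ forall x, Q' (F x) = F (Q x).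

End LodInfty.

Section Identities.
Variables (n p : nat).

(* Nonempty pairwise disjoint I^1, ..., I^s covering {0, ..., p-1}, with
   increasing last elements. *)
Definition ordered_unshuffles s (I : s.-tuple {set 'I_p}) : bool :=
  [&& all (fun A => A != finset.set0) I,
      pairwise (fun A B => A :&: B == finset.set0) I,
      (\bigcup_(A <- I) A)%SET == [set: 'I_p]%SET &
      sorted ltn [seq (\max_(i in A) i)%N | A : {set 'I_p} <- I]].

(* I, J, K pairwise disjoint with union {0, ..., p-1}, K nonempty and
   I, J < K. *)
Definition split_unshuffles (I J K : {set 'I_p}) : bool :=
  [&& K != finset.set0, I :&: J == finset.set0, I :&: K == finset.set0,
      J :&: K == finset.set0,
      (I :|: J :|: K)%SET == [set: 'I_p]%SET &
      [forall i in I, forall k in K, (i < k)%N] &&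
      [forall j in J, forall k in K, (j < k)%N]].

Definition sdeg (a : 'I_p -> deg n) (A : {set 'I_p}) : deg n :=
  \sum_(i in A) a i.

(* With r counted from 0, so that (s - r) becomes (s - r.+1). *)
Definition omega (a : 'I_p -> deg n) s (I : s.-tuple {set 'I_p}) : int :=
  ((s * s.-1)./2 + \sum_(r < s) (s - r.+1) * #|tnth I r|)%N%:Z +
  \sum_(r < s | (0 < r)%N)
    dot (e1 *+ #|tnth I r|.+1) (\sum_(q < s | (q < r)%N) sdeg a (tnth I q)).

Definition lambda (a : 'I_p -> deg n) (I J : {set 'I_p}) : int :=
  dot (e1 *+ #|J|.+1) (sdeg a I + e1 *+ p.+1).

End Identities.

(* Main.v *)
Require Import Defs.
From mathcomp Require Import boolp classical_sets functions.
From mathcomp Require Import cardinality fsbigop.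
From mathcomp Require Import all_boot all_order all_algebra.
From mathcomp Require Import zify ring.

(** Everything rests on the fact that a vector of the tensor coalgebra is
    recovered from its corestriction and its coproduct ([rebuild]): in the
    coproduct of a word [w_1 ... w_p] the term [w_1 ... w_(p-1) \ox w_p] is the
    only one whose second factor is a single letter, so applying the corestriction
    to the second factor and multiplying the two factors gives back the word.
    As the coproduct of a word involves shorter words only, this turns the
    defining equations of cohomomorphisms and coderivations into recursions on
    the length of words.

    Uniqueness follows by induction ([linear_eq_coprod]): a cohomomorphism is
    determined by its corestriction ([cohomomorphism_eq]), and so is a
    coderivation along a cohomomorphism.  Since [Q' \o F] and [F \o Q] are both
    coderivations along [F], they agree as soon as their corestrictions do
    ([intertwine_corestr]).

    For existence, the recursion defines a linear map [cofree g] with prescribed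
    corestriction [g].  That it respects the coproduct [D] is an induction on the
    length ([coprod_cofree]).  It uses that appending a letter turns the full
    unshuffle coproduct into [D] ([coprod_rmul]), that the full unshuffle
    coproduct is [D] plus its flip, so that it is respected whenever [D] is
    ([coprod_flip]), and that cutting an index set into three parts can be done in
    two ways ([coprod_unshuffle_assoc]).

    Unrolling the recursions gives the explicit formulas for [F], as a sum over
    ordered partitions ([cohomomorphism_blocks]), and for [Q]
    ([coderivation_prefix]).  Hence the two sides of the asserted identity are
    the corestrictions of [Q' \o F] and of [F \o Q] on the desuspended word, and
    only the signs remain to be compared.  Desuspension multiplies a word by a
    sign which changes, at each inversion, by the discrepancy between the Koszul
    signs of the shifted and of the original degrees ([koszul_desusp]); what is
    left is a computation with parities ([omega_blocks], [lambda_parity]). *)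

Set Implicit Arguments.
Unset Strict Implicit.
Unset Printing Implicit Defensive.

Import GRing.Theory.
Local Open Scope ring_scope.

(** * Linear and multilinear maps *)

Section LinearMaps.
Variables (K : fieldType) (U V W : lmodType K).
Implicit Types (f : U -> V) (g : V -> W).

Lemma linfD f x y : linear f -> f (x + y) = f x + f y.
Proof. by move=> h; have := h 1 x y; rewrite !scale1r. Qed.

Lemma linf0 f : linear f -> f 0 = 0.
Proof.
by move=> h; have := h (-1) 0 0; rewrite scaler0 addr0 scaleN1r addNr.
Qed.

Lemma linfZ f c x : linear f -> f (c *: x) = c *: f x.
Proof. by move=> h; have := h c x 0; rewrite linf0 // !addr0. Qed.

Lemma linf_sum f (I : Type) (r : seq I) (P : pred I) (E : I -> U) : linear f ->
  f (\sum_(i <- r | P i) E i) = \sum_(i <- r | P i) f (E i).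
Proof.
move=> h; apply: (big_morph f _ (linf0 h)) => x y; exact: linfD.
Qed.

Lemma linear_comp f g : linear f -> linear g -> linear (fun x => g (f x)).
Proof. by move=> hf hg c x y; rewrite hf hg. Qed.

End LinearMaps.

Section Multilinear.
Variables (K : fieldType) (U : lmodType K).

Lemma corestr_linear : linear (@corestr K U).
Proof. exact: ulift_linear (corestr_multilinear U). Qed.

Lemma corestr_tens (w : seq U) :
  corestr (tens w) = if w is [:: u] then u else 0.
Proof. exact: ulift_gen (corestr_multilinear U). Qed.

Lemma corestr_rcons (w : seq U) u :
  corestr (tens (rcons w u)) = if w is [::] then u else 0.
Proof. by rewrite corestr_tens; case: w => [|v [|v' w]]. Qed.

Definition letter (u : U) : tpowers U := tens [:: u].

Lemma letter_linear : linear letter.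
Proof. by move=> c x y; exact: ((tens_multilinear U).2 [::] [::]). Qed.

Lemma corestr_letter u : corestr (letter u) = u.
Proof. exact: corestr_tens. Qed.

Lemma multilinear_comp (M N : lmodType K) (f : seq U -> M) (g : M -> N) :
  multilinear f -> linear g -> multilinear (g \o f).
Proof.
move=> [f0 hf] hg; split=> [|s1 s2 c u v] /=; first by rewrite f0 linf0.
by rewrite hf hg.
Qed.

(** The value on the empty word is forced to be 0 because [tpowers] has no
    component of exponent 0; the product of the empty word with [u] therefore
    has to be treated separately, as [letter u]. *)
Definition rmul_word (u : U) (w : seq U) : tpowers U :=
  if w is [::] then 0 else tens (rcons w u).

Definition rmul (u : U) (x : tpowers U) : tpowers U := ulift (rmul_word u) x.

Lemma rmul_word_multilinear u : multilinear (rmul_word u).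
Proof.
split=> // -[|x s1] s2 c y z /=; rewrite ?rcons_cat /=.
  exact: ((tens_multilinear U).2 [::]).
exact: ((tens_multilinear U).2 (x :: s1)).
Qed.

Lemma rmul_linear u : linear (rmul u).
Proof. exact: ulift_linear (rmul_word_multilinear u). Qed.

Lemma rmul_tens u w : rmul u (tens w) = rmul_word u w.
Proof. exact: ulift_gen (rmul_word_multilinear u). Qed.

Lemma corestr_rmul u x : corestr (rmul u x) = 0.
Proof.
have lr := corestr_linear; have lm := @rmul_linear u.
apply: (univ_ind (adm := @multilinear K U)
  (P := fun x => corestr (rmul u x) = 0) _ _ _ x) => [|c y z hy hz|w].
- by rewrite (linf0 lm) (linf0 lr).
- by rewrite lm lr hy hz scaler0 addr0.
rewrite rmul_tens /rmul_word; case: w => [|y w]; first by rewrite (linf0 lr).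
by rewrite corestr_rcons.
Qed.

Lemma rmul_linearl x : linear (rmul^~ x).
Proof.
move=> c u v; have lr u' := @rmul_linear u'.
apply: (univ_ind (adm := @multilinear K U)
  (P := fun x => rmul (c *: u + v) x = c *: rmul u x + rmul v x) _ _ _ x)
  => [|d y z hy hz|w].
- by rewrite !(linf0 (lr _)) scaler0 addr0.
- rewrite !lr hy hz !scalerDr !scalerA [d * c]mulrC.
  by rewrite -!addrA; congr (_ + _); rewrite addrCA.
- rewrite !rmul_tens /rmul_word; case: w => [|y w].
    by rewrite scaler0 addr0.
  rewrite -!cats1; exact: (tens_multilinear U).2.
Qed.

End Multilinear.

Section TensorProducts.
Variables (K : fieldType).

Lemma tens2_linearl (U V : lmodType K) (v : V) :
  linear (fun u : U => u \ox v).
Proof. exact: (tens2_bilinear U V).1. Qed.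

Lemma tens2_linearr (U V : lmodType K) (u : U) :
  linear (fun v : V => u \ox v).
Proof. exact: (tens2_bilinear U V).2. Qed.

(** The product of a word by the letter that a second map extracts from the
    other tensor factor: [x \ox y |-> F x . G y].  With [F = id] and
    [G = corestr] it rebuilds a word from its coproduct; with the corestriction
    of a cohomomorphism it gives the recursion that determines the latter. *)
Definition mulmap (U' : lmodType K) (A B : lmodType K)
    (F : A -> tpowers U') (G : B -> U') (x : tensor A B) : tpowers U' :=
  ulift (fun xy => rmul (G xy.2) (F xy.1)) x.

Section MulMap.
Variables (U' A B : lmodType K) (F : A -> tpowers U') (G : B -> U').
Hypotheses (hF : linear F) (hG : linear G).

Lemma mulmap_bilinear :
  bilinear_map (fun xy => rmul (G xy.2) (F xy.1)).
Proof.
split=> z c x y /=; first by rewrite hF rmul_linear.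
by rewrite hG rmul_linearl.
Qed.

End MulMap.
End TensorProducts.

Section MulMapTheory.
Variables (K : fieldType) (U' A B : lmodType K).
Variables (F : A -> tpowers U') (G : B -> U').
Hypotheses (hF : linear F) (hG : linear G).

Lemma mulmap_linear : linear (mulmap F G).
Proof. exact: ulift_linear (mulmap_bilinear hF hG). Qed.

Lemma mulmap_tens2 x y : mulmap F G (x \ox y) = rmul (G y) (F x).
Proof. exact: ulift_gen (mulmap_bilinear hF hG). Qed.

End MulMapTheory.

(** * Homogeneous vectors, Koszul signs and the flip *)

(** Signs are computed with exponents in Z/2, represented by booleans, so that
    the comparison of two signs becomes a propositional tautology. *)
Definition par (x : int) : bool := odd `|x|%N.

Lemma parD x y : par (x + y) = par x (+) par y.
Proof. rewrite /par; lia. Qed.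

Lemma parN x : par (- x) = par x.
Proof. by rewrite /par abszN. Qed.

Lemma sign_par (K : fieldType) x : (-1) ^ x = (-1) ^+ par x :> K.
Proof.
rewrite /par signr_odd; case: x => m //=.
by rewrite NegzE -exprnN -exprVn invrN1.
Qed.

Section Graded.
Variables (K : fieldType) (n : nat).
Implicit Types V W : gspace K n.

Lemma dot0l (b : deg n) : dot 0 b = 0.
Proof. by rewrite /dot big1 // => i _; rewrite mxE mul0r. Qed.

Lemma dotC (b c : deg n) : dot b c = dot c b.
Proof. by apply: eq_bigr => i _; rewrite mulrC. Qed.

Lemma dotDl (b c d : deg n) : dot (b + c) d = dot b d + dot c d.
Proof. by rewrite /dot -big_split; apply: eq_bigr => i _; rewrite mxE mulrDl. Qed.

Lemma dotNl (b c : deg n) : dot (- b) c = - dot b c.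
Proof. by rewrite /dot -sumrN; apply: eq_bigr => i _; rewrite mxE mulNr. Qed.

Lemma dsignDl (b c d : deg n) : dsign K (b + c) d = dsign K b d * dsign K c d.
Proof. by rewrite /dsign dotDl expfzDr // oppr_eq0 oner_eq0. Qed.

Lemma dsignC (b c : deg n) : dsign K b c = dsign K c b.
Proof. by rewrite /dsign dotC. Qed.

Lemma dsign0l (b : deg n) : dsign K 0 b = 1.
Proof. by rewrite /dsign dot0l expr0z. Qed.

Lemma dsign0r (b : deg n) : dsign K b 0 = 1.
Proof. by rewrite dsignC dsign0l. Qed.

Lemma dsign_sum (I : Type) (r : seq I) (P : pred I) (F : I -> deg n) d :
  dsign K (\sum_(i <- r | P i) F i) d = \prod_(i <- r | P i) dsign K (F i) d.
Proof.
by apply: (big_morph (fun b => dsign K b d)) => [b c|];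
  rewrite ?dsignDl ?dsign0l.
Qed.

Lemma dsign_sqr (b c : deg n) : dsign K b c * dsign K b c = 1.
Proof.
by rewrite /dsign sign_par -signr_addb addbb.
Qed.

Lemma ksign0 V (v : V) : ksign 0 v = v.
Proof.
rewrite -[RHS]gproj_sum; apply: eq_fsbigr => a _.
by rewrite dsign0l scale1r.
Qed.

Lemma ghomZ V a c (v : V) : ghom a v -> ghom a (c *: v).
Proof. by move=> h; rewrite /ghom (linfZ _ _ (gproj_linear (g := V) a)) h. Qed.

Lemma ghom_add V a (u v : V) : ghom a u -> ghom a v -> ghom a (u + v).
Proof.
by move=> hu hv; rewrite /ghom (linfD _ _ (gproj_linear (g := V) a)) hu hv.
Qed.

Lemma ghom0 V a : ghom a (0 : V).
Proof. exact: gproj0. Qed.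

Lemma ghom_sum V a (I : Type) (r : seq I) (P : pred I) (F : I -> V) :
  (forall i, P i -> ghom a (F i)) -> ghom a (\sum_(i <- r | P i) F i).
Proof.
move=> h; apply: (big_ind (fun v => ghom a v)) => //; first exact: ghom0.
by move=> u v; exact: ghom_add.
Qed.

Lemma tensor_map_bilinear V W V' W' (f : V -> V') b (g : W -> W') :
  linear f -> linear g ->
  bilinear_map (fun vw => f (ksign b vw.1) \ox g vw.2).
Proof.
move=> hf hg; split=> [w|v] c x y /=.
  by rewrite ksign_linear hf (tens2_linearl (g w)).
by rewrite hg (tens2_linearr (f (ksign b v))).
Qed.

Lemma tensor_map_linear V W V' W' (f : V -> V') b (g : W -> W') :
  linear f -> linear g -> linear (tensor_map f b g).
Proof. by move=> hf hg; exact: ulift_linear (tensor_map_bilinear b hf hg). Qed.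

Lemma tensor_map_tens2 V W V' W' (f : V -> V') b (g : W -> W') v w :
  linear f -> linear g -> tensor_map f b g (v \ox w) = f (ksign b v) \ox g w.
Proof. by move=> hf hg; exact: ulift_gen (tensor_map_bilinear b hf hg). Qed.

Lemma tensor_map_hom V W V' W' (f : V -> V') b (g : W -> W') a v w :
  linear f -> linear g -> ghom a v ->
  tensor_map f b g (v \ox w) = dsign K b a *: (f v \ox g w).
Proof.
move=> hf hg hv; rewrite tensor_map_tens2 // (ksign_hom _ hv) (linfZ _ _ hf).
by rewrite (linfZ _ _ (tens2_linearl (g w))).
Qed.

Lemma tensor_map_hom0 V W V' W' (f : V -> V') (g : W -> W') v w :
  linear f -> linear g -> tensor_map f 0 g (v \ox w) = f v \ox g w.
Proof. by move=> hf hg; rewrite tensor_map_tens2 // ksign0. Qed.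

Section Flip.
Variable W : gspace K n.

Definition flip_pair (xy : W * W) : tensor W W :=
  \sum_(a \in [set: deg n]%classic) ksign a xy.2 \ox gproj W a xy.1.

(** The signed transposition: [x \ox y] goes to [(-1)^<x,y> y \ox x], for
    homogeneous [x] and [y]. *)
Definition flip (x : tensor W W) : tensor W W := ulift flip_pair x.

Lemma flip_pair_finite (x y : W) :
  finite_set [set a | ksign a y \ox gproj W a x != 0]%classic.
Proof.
have [s _ hs] := finite_cover (gproj_finite x).
apply: (cover_finite (s := s)) => a /hs ->.
exact: (linf0 (tens2_linearr _)).
Qed.

Lemma flip_pair_bilinear : bilinear_map flip_pair.
Proof.
split=> [y|x] c u v; rewrite /flip_pair /= -fsum_linear;
    try exact: flip_pair_finite.
  by apply: eq_fsbigr => a _; rewrite gproj_linear (tens2_linearr _ c).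
apply: eq_fsbigr => a _; rewrite ksign_linear.
exact: (tens2_linearl _ c).
Qed.

Lemma flip_linear : linear flip.
Proof. exact: ulift_linear flip_pair_bilinear. Qed.

Lemma flip_hom a b (x y : W) : ghom a x -> ghom b y ->
  flip (x \ox y) = dsign K a b *: (y \ox x).
Proof.
move=> hx hy; rewrite /flip (ulift_gen _ flip_pair_bilinear) /flip_pair /=.
rewrite (fsumE (s := [:: a])) ?big_seq1 ?hx // => [|c].
  by rewrite (ksign_hom _ hy) (linfZ _ _ (tens2_linearl x)).
rewrite inE -hx gproj_proj => /negbTE ->.
exact: (linf0 (tens2_linearr _)).
Qed.

End Flip.

Section TotalDegree.
Variable W : gspace K n.

Lemma ghom_tens (l : seq (deg n * W)) : homlist l ->
  @ghom K n (tspace W) (\sum_(x <- l) x.1) (tens [seq x.2 | x <- l]).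
Proof. by move=> hl; rewrite /ghom /= tproj_hom // /tproj_word eqxx. Qed.

Lemma has_weight_words (W' : gspace K n) b (f : tspace W -> W') : linear f ->
  (forall l : seq (deg n * W), homlist l ->
     ghom (\sum_(x <- l) x.1 + b) (f (tens [seq x.2 | x <- l]))) ->
  has_weight b f.
Proof.
move=> hf h a x; rewrite /ghom /= => <-.
have lp := @tproj_linear K n W a.
elim/tpowers_homind: x => [|c x y hx hy|l hl].
- by rewrite (linf0 lp) (linf0 hf) gproj0.
- by rewrite lp hf gproj_linear hx hy.
- by rewrite (tproj_hom _ hl) /tproj_word; case: eqP => [<-|_];
    [exact: h | rewrite (linf0 hf) gproj0].
Qed.

Lemma letter_weight a (u : W) : ghom a u -> @ghom K n (tspace W) a (letter u).
Proof.
move=> hu; have := @ghom_tens [:: (a, u)]; rewrite big_seq1; apply=> x.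
by rewrite inE => /eqP ->.
Qed.

Lemma corestr_weight : @has_weight K n (tspace W) W 0 (@corestr K W).
Proof.
apply: has_weight_words => [|l hl];
  first exact: corestr_linear.
rewrite corestr_tens addr0; case: l hl => [|[a u] [|y l]] hl /=;
  try exact: ghom0.
by rewrite big_seq1; apply: (hl (a, u)); rewrite inE.
Qed.

Lemma rmul_weight b (u : W) : ghom b u ->
  @has_weight K n (tspace W) (tspace W) b (rmul u).
Proof.
move=> hu a x; rewrite /ghom /= => <-.
have lp c := @tproj_linear K n W c; have lr := rmul_linear u.
elim/tpowers_homind: x => [|c x y hx hy|l hl].
- by rewrite (linf0 (lp _)) (linf0 lr) (linf0 (lp _)).
- by rewrite (lp a) lr (lp (a + b)) hx hy.
- rewrite (tproj_hom _ hl) /tproj_word; case: eqP => [<-|_]; last first.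
    by rewrite (linf0 lr) (linf0 (lp _)).
  rewrite rmul_tens /rmul_word.
  case: l hl => [|z l] hl; first by rewrite (linf0 (lp _)).
  have h : @homlist K n W (rcons (z :: l) (b, u)).
    by move=> x; rewrite mem_rcons inE => /orP[/eqP ->|/hl].
  have := ghom_tens h; rewrite /ghom /= map_rcons -rcons_cons big_rcons /=.
  by rewrite addrC.
Qed.

End TotalDegree.
End Graded.

(** * Koszul signs of unshuffles *)

Section Unshuffles.
Variable p : nat.
Implicit Types (A B C : {set 'I_p}) (s t : seq 'I_p).

Definition ltI : rel 'I_p := fun i j => (i < j)%N.

Lemma ltI_trans : transitive ltI.
Proof. by move=> j i k; exact: ltn_trans. Qed.

Lemma ltI_irr : irreflexive ltI.
Proof. by move=> i; exact: ltnn. Qed.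

Lemma sorted_enum A : sorted ltI (enum A).
Proof.
rewrite {1}/enum_mem; apply: sorted_filter; first exact: ltI_trans.
rewrite -enumT; have := iota_ltn_sorted 0 p; rewrite -val_enum_ord.
by rewrite sorted_map.
Qed.

Lemma enum_sortedE A s : sorted ltI s -> s =i A -> enum A = s.
Proof.
move=> ss sA; apply: (irr_sorted_eq ltI_trans ltI_irr (sorted_enum A) ss).
by move=> i; rewrite mem_enum sA.
Qed.

Definition hi A : nat := \max_(i in A) i.

Definition hi_lt A B : bool :=
  [&& A != finset.set0, B != finset.set0 & (hi A < hi B)%N].

(** The unshuffles [(B; A \ B)] of the coproduct are those whose second part
    contains the last element of [A].  Saying so by comparing maxima makes the
    unshuffles of the flipped coproduct the ones with the opposite comparison,
    and is the form in which ordered partitions are given. *)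
Definition coprod_unshuffle A B : bool := (B \subset A) && hi_lt B (A :\: B).

Lemma hi_in A : A != finset.set0 -> exists2 i, i \in A & hi A = i.
Proof.
move=> A0; have cA : (0 < #|A|)%N by rewrite card_gt0.
by have [j jA E] := eq_bigmax_cond (fun i : 'I_p => val i) cA; exists j.
Qed.

Lemma le_hi A i : i \in A -> (i <= hi A)%N.
Proof. by move=> iA; exact: (leq_bigmax_cond (F := fun i : 'I_p => val i) i iA). Qed.

Lemma hiU A B : hi (A :|: B) = maxn (hi A) (hi B).
Proof.
apply/eqP; rewrite eqn_leq geq_max; apply/and3P; split.
- apply/bigmax_leqP => i; rewrite inE leq_max => /orP[/le_hi ->//|/le_hi ->].
  by rewrite orbT.
- by apply/bigmax_leqP => i iA; apply: le_hi; rewrite inE iA.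
- by apply/bigmax_leqP => i iB; apply: le_hi; rewrite inE iB orbT.
Qed.

Lemma hi_neq A B : A != finset.set0 -> B != finset.set0 -> [disjoint A & B] ->
  hi A != hi B.
Proof.
move=> /hi_in[i iA ->] /hi_in[j jB ->] dAB; apply/eqP => /val_inj ij.
by move: dAB; rewrite disjoint_subset => /subsetP/(_ i iA); rewrite ij inE jB.
Qed.

Lemma coprod_unshuffleU A m B : m \notin A -> (forall i, i \in A -> (i < m)%N) ->
  coprod_unshuffle (m |: A) B = (B \subset A) && (B != finset.set0).
Proof.
move=> mA ltm; apply/idP/idP.
  case/andP=> BA /and3P[B0 C0 h]; rewrite B0 andbT.
  have mB : m \notin B.
    apply/negP => mB; have [i] := hi_in C0; rewrite !inE => /andP[iB].
    case/orP => [/eqP im|iA] E; first by rewrite im mB in iB.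
    have := leq_ltn_trans (le_hi mB) h; rewrite E => mi.
    by have := ltn_trans mi (ltm _ iA); rewrite ltnn.
  apply/subsetP => i iB; have := subsetP BA i iB; rewrite !inE.
  by case/orP => // /eqP im; rewrite -im iB in mB.
case/andP=> BA B0; have mB : m \notin B by apply: contra mA; exact: subsetP.
apply/andP; split; first exact: fintype.subset_trans BA (subsetUr _ _).
have mC : m \in (m |: A) :\: B by rewrite !inE mB eqxx.
apply/and3P; split => //; first by apply/finset.set0Pn; exists m.
have [i iB ->] := hi_in B0; apply: leq_trans (le_hi mC).
exact: ltm (subsetP BA _ iB).
Qed.

(** Coassociativity on the level of index sets: the two ways of cutting [A] into
    three parts, the third containing the last letter, correspond. *)
Lemma coprod_unshuffle_assoc A C D : coprod_unshuffle A C ->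
  coprod_unshuffle (A :\: C) D =
  [&& coprod_unshuffle A (C :|: D), D != finset.set0 & [disjoint C & D]].
Proof.
case/andP=> CA /and3P[C0 _ hC]; rewrite /coprod_unshuffle /hi_lt subsetD.
rewrite subUset CA /= setDDl disjoint_sym.
case: (D \subset A) / idP => DA; rewrite ?andbF //=.
case: [disjoint C & D] / idP => CD; rewrite ?andbF //= andbT.
have -> : C :|: D != finset.set0.
  have [i iC] := finset.set0Pn _ C0.
  by apply/finset.set0Pn; exists i; rewrite inE iC.
case: (D == finset.set0) / eqP => D0; rewrite ?andbF //= andbT.
case: (_ == finset.set0) / eqP => //= E0; rewrite hiU gtn_max.
have DCA : D \subset A :\: C by rewrite subsetD DA disjoint_sym.
have := hC; rewrite -(setID (A :\: C) D) (setIidPr DCA) setDDl hiU leq_max.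
case: (ltnP (hi D)) => [DE|_]; rewrite ?andbF // andbT.
by case/orP => [/ltn_trans->|->].
Qed.

Lemma coprod_unshuffleW A B C : coprod_unshuffle A B -> C \subset B ->
  C != finset.set0 -> coprod_unshuffle A C.
Proof.
move=> /andP[BA /and3P[B0 D0 hB]] CB C0; rewrite /coprod_unshuffle /hi_lt C0 /=.
have DD : A :\: B \subset A :\: C by exact: setDS.
rewrite (fintype.subset_trans CB BA) /=; apply/andP; split.
  by have [i iD] := finset.set0Pn _ D0; apply/finset.set0Pn; exists i;
    exact: subsetP DD i iD.
have := hB; rewrite -[X in (hi X < _)%N](setUidPr CB) hiU gtn_max.
case/andP=> hC _.
by rewrite -(setUidPr DD) hiU leq_max hC.
Qed.

Lemma coprod_unshuffle_card A B : coprod_unshuffle A B ->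
  ((#|B| < #|A|) && (#|A :\: B| < #|A|))%N.
Proof.
case/andP=> BA /and3P[B0 C0 _]; rewrite !proper_card //.
  rewrite properE subsetDl; apply/subsetPn; have [i iB] := finset.set0Pn _ B0.
  by exists i; rewrite ?(subsetP BA) // !inE iB.
rewrite properE BA; apply/subsetPn; have [i] := finset.set0Pn _ C0.
by rewrite inE => /andP[iB iA]; exists i.
Qed.

Lemma prod_disjointU (R : comPzSemiRingType) A B (P : pred 'I_p)
    (F : 'I_p -> R) : [disjoint A & B] ->
  \prod_(i in A :|: B | P i) F i =
  \prod_(i in A | P i) F i * \prod_(i in B | P i) F i.
Proof.
move=> h; rewrite !big_mkcondr -bigU //; apply: eq_bigl => i.
by rewrite !inE.
Qed.

Variables (K : fieldType) (n : nat).
Implicit Type d : 'I_p -> deg n.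

(** The sign [koszul] of the concatenation of [enum A] and [enum B].  In this
    form it is visibly multiplicative in each of the two sets. *)
Definition ukoszul d A B : K :=
  \prod_(i in A) \prod_(j in B | (j < i)%N) dsign K (d i) (d j).

Lemma ukoszul0l d B : ukoszul d finset.set0 B = 1.
Proof. by rewrite /ukoszul big_set0. Qed.

Lemma ukoszulUl d A B C : [disjoint A & B] ->
  ukoszul d (A :|: B) C = ukoszul d A C * ukoszul d B C.
Proof.
move=> h; have := prod_disjointU xpredT
  (fun i => \prod_(j in C | (j < i)%N) dsign K (d i) (d j)) h.
rewrite /ukoszul => E; rewrite [LHS](eq_bigl (fun i => (i \in A :|: B) && true)) ?E.
  by congr (_ * _); apply: eq_bigl => i; rewrite andbT.
by move=> i; rewrite andbT.
Qed.

Lemma ukoszulUr d A B C : [disjoint B & C] ->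
  ukoszul d A (B :|: C) = ukoszul d A B * ukoszul d A C.
Proof.
move=> h; rewrite /ukoszul -big_split; apply: eq_bigr => i _ /=.
exact: prod_disjointU.
Qed.

(** Exchanging the two parts of an unshuffle costs the sign of a transposition
    of the two words. *)
Lemma ukoszulC d A B : [disjoint A & B] ->
  ukoszul d A B * dsign K (sdeg d A) (sdeg d B) = ukoszul d B A.
Proof.
move=> h; rewrite {2}/ukoszul (exchange_big_dep (mem A)) /=; last first.
  by move=> i j _ /andP[].
rewrite /sdeg dsign_sum /ukoszul -big_split; apply: eq_bigr => i iA /=.
rewrite dsignC dsign_sum (bigID (fun j : 'I_p => (j < i)%N) (mem B)) /=.
rewrite mulrA -big_split /= big1 ?mul1r; last first.
  by move=> j _; rewrite [X in _ * X]dsignC dsign_sqr.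
apply: eq_bigl => j; case jB : (j \in B); rewrite ?iA //=.
rewrite -leqNgt [in RHS]ltn_neqAle.
case: eqP => //= /val_inj ij; move: h; rewrite disjoint_subset.
by move=> /subsetP/(_ i iA); rewrite inE ij jB.
Qed.

Lemma koszul_sorted d s : sorted ltI s -> koszul K d s = 1.
Proof.
rewrite /koszul sorted_pairwise; last exact: ltI_trans.
elim: s => [|i s IH] /=; first by rewrite big_nil.
case/andP=> /allP h /IH E; rewrite big_cat /= E mulr1 big_map big_filter.
by rewrite big_seq_cond big1 // => j /andP[/h]; rewrite /ltI ltnNge; case: ltngtP.
Qed.

Lemma koszul_cat d s t : koszul K d (s ++ t) = koszul K d s * koszul K d t *
  \prod_(i <- s) \prod_(j <- t | (j < i)%N) dsign K (d i) (d j).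
Proof.
rewrite /koszul; elim: s => [|i s IH] /=; first by rewrite !big_nil mul1r mulr1.
rewrite !big_cat IH !big_cons /= filter_cat map_cat big_cat /= -!mulrA.
congr (_ * _); rewrite big_map big_filter mulrCA; congr (_ * _).
by rewrite mulrCA.
Qed.

Lemma koszul_enum2 d A B : koszul K d (enum A ++ enum B) = ukoszul d A B.
Proof.
rewrite koszul_cat !koszul_sorted ?sorted_enum // !mul1r /ukoszul.
by rewrite big_enum; apply: eq_bigr => i _; rewrite big_enum_cond.
Qed.

End Unshuffles.

(** * The coproduct *)

Section Coproduct.
Variables (K : fieldType) (n : nat).
Implicit Types W : gspace K n.

(** The letters of a word are indexed once and for all by an ordinal, so that
    every word occurring in an iterated coproduct is [word w A] for a set [A] of
    indices, and iterated unshuffles become set operations. *)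
Definition word p W (w : 'I_p -> W) (A : {set 'I_p}) : tspace W :=
  tens (select w A).

Lemma word0 p W (w : 'I_p -> W) : word w finset.set0 = 0.
Proof. by rewrite /word /select enum_set0; exact: (tens_multilinear W).1. Qed.

Lemma homlist_indexed p W (a : 'I_p -> deg n) (w : 'I_p -> W) (s : seq 'I_p) :
  (forall i, ghom (a i) (w i)) -> @homlist K n W [seq (a i, w i) | i <- s].
Proof. by move=> hw x /mapP[i _ ->]; exact: hw. Qed.

Lemma ghom_word p W (a : 'I_p -> deg n) (w : 'I_p -> W) A :
  (forall i, ghom (a i) (w i)) -> ghom (sdeg a A) (word w A).
Proof.
move=> hw; have := ghom_tens (homlist_indexed (s := enum A) hw).
by rewrite big_map -map_comp big_enum.
Qed.

Lemma select_nth W (l : seq (deg n * W)) :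
  select (fun i : 'I_(size l) => (l`_i).2) [set: 'I_(size l)]%SET =
  [seq x.2 | x <- l].
Proof.
rewrite /select enum_setT -enumT.
rewrite (map_comp (fun i => (l`_i).2) val) val_enum_ord.
by rewrite (map_comp snd (nth 0 l)) map_nth_iota0 // take_size.
Qed.

Lemma homlist_word W (l : seq (deg n * W)) : homlist l ->
  exists (p : nat) (a : 'I_p -> deg n) (w : 'I_p -> W),
    [/\ forall i, ghom (a i) (w i),
        [seq x.2 | x <- l] = select w [set: 'I_p]%SET &
        \sum_(x <- l) x.1 = sdeg a [set: 'I_p]%SET].
Proof.
move=> hl; exists (size l), (fun i => (l`_i).1), (fun i => (l`_i).2).
split=> [i||]; [by apply: hl; rewrite mem_nth | by rewrite select_nth |].
rewrite (big_nth 0) big_mkord /sdeg; apply: eq_bigl => i.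
by rewrite inE.
Qed.

Lemma tspace_ind W (P : tspace W -> Prop) :
  P 0 -> (forall c x y, P x -> P y -> P (c *: x + y)) ->
  (forall p (a : 'I_p -> deg n) (w : 'I_p -> W),
     (forall i, ghom (a i) (w i)) -> P (word w [set: 'I_p]%SET)) ->
  forall x, P x.
Proof.
move=> P0 Plin Pword; apply: tpowers_homind => // l hl.
by have [p [a [w [hw -> _]]]] := homlist_word hl; exact: Pword.
Qed.

Lemma coprod_word_rcons W (l : seq (deg n * W)) x :
  coprod_word (rcons l x) =
  \sum_(I : {set 'I_(size l)} | I != finset.set0)
    ukoszul K (fun i : 'I_(size l) => (l`_i).1) I (~: I) *:
    (word (fun i : 'I_(size l) => (l`_i).2) I \ox
     (tens (rcons (select (fun i : 'I_(size l) => (l`_i).2) (~: I)) x.2)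
       : tspace W)).
Proof.
rewrite /coprod_word size_rcons /=; apply: eq_bigr => I _.
have E (i : 'I_(size l)) : (rcons l x)`_i = l`_i by rewrite nth_rcons ltn_ord.
rewrite nth_rcons ltnn eqxx koszul_enum2 /word /select.
congr (ukoszul _ _ _ _ *: (tens _ \ox tens (rcons _ _))).
- by apply/funext => i; rewrite E.
- by apply: eq_map => i; rewrite E.
- by apply: eq_map => i; rewrite E.
Qed.

Section Indexed.
Variables (p : nat) (W : gspace K n) (a : 'I_p -> deg n) (w : 'I_p -> W).
Hypothesis hw : forall i, ghom (a i) (w i).

(** [coprod_word] numbers the letters of each word from 0, whereas the letters of
    [word w A] keep their numbers; an increasing map between the two numberings
    changes neither the order of the letters nor the signs. *)
Section MonotoneReindexing.
Variables (k : nat) (e : 'I_k -> 'I_p).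
Hypothesis e_mono : forall i j, (e i < e j)%N = (i < j)%N.

Lemma mono_inj : injective e.
Proof.
by move=> i j eij; case: (ltngtP i j) => [| |/val_inj //]; rewrite -e_mono eij ltnn.
Qed.

Lemma enum_imset (I : {set 'I_k}) : enum (e @: I) = [seq e i | i <- enum I].
Proof.
apply: enum_sortedE.
  rewrite sorted_map (eq_sorted (e' := @ltI k)) ?sorted_enum //.
move=> j; apply/mapP/imsetP => -[i]; rewrite ?mem_enum => iI ->; exists i => //.
by rewrite mem_enum.
Qed.

Lemma ukoszul_imset (I J : {set 'I_k}) :
  ukoszul K (a \o e) I J = ukoszul K a (e @: I) (e @: J).
Proof.
rewrite /ukoszul big_imset /=; last by move=> ? ? _ _; exact: mono_inj.
apply: eq_bigr => i _; rewrite [RHS]big_mkcondr big_imset /=; last first.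
  by move=> ? ? _ _; exact: mono_inj.
by rewrite [LHS]big_mkcondr; apply: eq_bigr => j _; rewrite e_mono.
Qed.

End MonotoneReindexing.

Lemma coprod_unshuffles (A : {set 'I_p}) :
  coprod (word w A) = \sum_(B | coprod_unshuffle A B)
    ukoszul K a B (A :\: B) *: (word w B \ox word w (A :\: B)).
Proof.
have [->|A0] := eqVneq A finset.set0.
  rewrite word0 (linf0 (@coprod_linear K n W)) big_pred0 // => B.
  by apply/negP => /andP[_ /and3P[_]]; rewrite set0D eqxx.
have [m mA hm] := hi_in A0; pose A' := A :\ m.
have mA' : m \notin A' by rewrite !inE eqxx.
have ltm i : i \in A' -> (i < m)%N.
  rewrite !inE => /andP[im iA]; rewrite ltn_neqAle -[X in (_ <= X)%N]hm le_hi //.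
  by rewrite andbT; apply: contraNneq im => /val_inj ->.
have AE : A = m |: A' by rewrite setD1K.
(* The last letter [m] of the word stays at the end of the second factor, and
   [A'] is what [coprod_word] distributes among the two factors. *)
have enA : enum A = rcons (enum A') m.
  apply: enum_sortedE => [|i]; last first.
    by rewrite AE mem_rcons !inE mem_enum !inE.
  have := sorted_enum A'; case E : (enum A') => [//|j s] /= js.
  rewrite rcons_path js /= /ltI ltm // -mem_enum E; exact: mem_last.
set l := [seq (a i, w i) | i <- enum A'].
have szl : size l = size (enum A') by rewrite size_map.
have -> : word w A = tens [seq x.2 | x <- rcons l (a m, w m)].
  by rewrite /word /select enA !map_rcons -map_comp.
have hl : homlist (rcons l (a m, w m)).
  by rewrite /l -map_rcons; exact: homlist_indexed.
rewrite coprod_hom // coprod_word_rcons.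
pose e (i : 'I_(size l)) := nth m (enum A') i.
have lE (i : 'I_(size l)) : l`_i = (a (e i), w (e i)).
  by rewrite (nth_map m) // -szl.
have e_mono (i j : 'I_(size l)) : (e i < e j)%N = (i < j)%N.
  have := sorted_enum A'; rewrite sorted_pairwise; last exact: ltI_trans.
  move=> /(pairwiseP m) h; have hi q : (q < size l)%N -> q \in gtn (size (enum A')).
    by rewrite inE szl.
  case: (ltngtP i j) => [ij|ij|/val_inj ->]; last by rewrite ltnn.
  - by apply: h ij; apply: hi.
  - by apply/negbTE; rewrite -leqNgt ltnW //; apply: h ij; apply: hi.
have e_inj := mono_inj e_mono.
have eA' : e @: [set: 'I_(size l)]%SET = A'.
  apply/setP => j; apply/imsetP/idP => [[i _ ->]|].
    by rewrite -mem_enum mem_nth // -szl.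
  rewrite -mem_enum => jA; have hj : (index j (enum A') < size l)%N.
    by rewrite szl index_mem.
  by exists (Ordinal hj); rewrite // /e nth_index.
rewrite [RHS](reindex_onto (fun I : {set 'I_(size l)} => e @: I)
  (fun B : {set 'I_p} => e @^-1: B)) /=; last first.
  move=> B; rewrite AE coprod_unshuffleU // => /andP[BA _].
  apply/setP => j; apply/imsetP/idP => [[i]|jB]; first by rewrite inE => h ->.
  have := subsetP BA j jB; rewrite -eA' => /imsetP[i _ ji].
  by exists i; rewrite // inE -ji.
apply: eq_big => I.
  rewrite AE coprod_unshuffleU // -eA' imsetS ?subsetT //=.
  have -> : e @^-1: (e @: I) == I.
    by apply/eqP/setP => i; rewrite inE (mem_imset _ _ e_inj).
  by rewrite andbT -!card_gt0 (card_imset _ e_inj).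
move=> I0; have sub_A' (J : {set 'I_(size l)}) j : j \in e @: J -> j \in A'.
  by case/imsetP=> i _ ->; rewrite -eA'; exact: imset_f.
have mI (J : {set 'I_(size l)}) : m \notin e @: J by apply: contra mA'; exact: sub_A'.
have IE : A :\: e @: I = m |: e @: (~: I).
  rewrite AE -eA' -setTD; apply/setP => j; rewrite !inE.
  have [-> /=|jm /=] := eqVneq j m; first by rewrite mI.
  apply/andP/imsetP => [[jI /imsetP[i _ ji]]|[i]].
    exists i => //; rewrite !inE andbT; apply: contra jI => iI.
    by rewrite ji imset_f.
  rewrite !inE andbT => iI ->; split; last exact: imset_f.
  by rewrite (mem_imset _ _ e_inj).
have enIE : enum (A :\: e @: I) = rcons [seq e i | i <- enum (~: I)] m.
  rewrite IE -(enum_imset e_mono) ; apply: enum_sortedE => [|i]; last first.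
    by rewrite mem_rcons !inE mem_enum.
  have := sorted_enum (e @: ~: I).
  case E : (enum (e @: ~: I)) => [//|j s] /= js.
  rewrite rcons_path js /= /ltI ltm // (sub_A' (~: I)) // -mem_enum E.
  exact: mem_last.
congr (_ *: (_ \ox _)).
- rewrite IE ukoszulUr ?disjoints1 ?mI // -(ukoszul_imset e_mono).
  rewrite [X in _ = X * _]/ukoszul big1 ?mul1r => [|i /imsetP[j _ ->]].
    by congr ukoszul; apply/funext => i; rewrite lE.
  rewrite big_pred0 // => q; rewrite !inE; case: eqP => //= ->.
  apply/negbTE; rewrite -leqNgt ltnW // ltm // -eA'; exact: imset_f.
- rewrite /word /select (enum_imset e_mono) -map_comp; congr tens.
  by apply: eq_map => q; rewrite lE.
- rewrite /word /select enIE map_rcons -map_comp; congr (tens (rcons _ _)).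
  by apply: eq_map => q; rewrite lE.
Qed.

End Indexed.
End Coproduct.

Section CoproductTheory.
Variables (K : fieldType) (n : nat).
Implicit Types W : gspace K n.

(** Among the unshuffles in the coproduct of a word, only the one that leaves the
    last letter alone has a second factor of length one, and the product of its
    two factors is the word. *)
Lemma rebuild W (x : tspace W) :
  x = letter (corestr x) + mulmap id (@corestr K W) (coprod x).
Proof.
have lm : linear (mulmap id (@corestr K W)).
  apply: mulmap_linear => //; exact: corestr_linear.
have lr := @corestr_linear K W; have ll := @letter_linear K W.
have lc := @coprod_linear K n W.
elim/tpowers_homind: x => [|c x y {1}-> {1}->|l hl].
- by rewrite (linf0 lr) (linf0 ll) (linf0 lc) (linf0 lm) addr0.
- by rewrite lr ll lc lm scalerDr !addrA; congr (_ + _); rewrite addrAC.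
rewrite coprod_hom //; elim/last_ind: l hl => [|l x _] hl.
  rewrite coprod_word_nil (linf0 lm) addr0 /= (tens_multilinear W).1.
  by rewrite (linf0 lr) (linf0 ll).
rewrite coprod_word_rcons (linf_sum _ _ _ lm) map_rcons corestr_rcons.
have [->|l0] := eqVneq l [::].
  rewrite big_pred0 ?addr0 // => I; apply/negbTE; rewrite negbK.
  by apply/eqP/setP => -[].
have -> : (if map snd l is [::] then x.2 else 0) = 0 by case: l l0 {hl}.
rewrite (linf0 ll) add0r.
have T0 : [set: 'I_(size l)]%SET != finset.set0.
  case: l l0 {hl} => // y l _.
  by apply/finset.set0Pn; exists ord0; rewrite inE.
have lid : linear (@id (tspace W)) by [].
(* The summand with [I] everything has the last letter alone as its second
   factor; the corestriction kills all the others. *)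
rewrite (bigD1 [set: 'I_(size l)]%SET) //= big1 ?addr0 => [|I /andP[_ IT]].
  rewrite (linfZ _ _ lm) mulmap_tens2 // setCT corestr_rcons.
  rewrite /ukoszul big1 ?scale1r => [|i _]; last first.
    by rewrite big_pred0 // => j; rewrite inE.
  rewrite /word select_nth /select enum_set0 /= rmul_tens.
  by case: l l0 {hl T0}.
rewrite (linfZ _ _ lm) mulmap_tens2 // corestr_rcons.
have [j jI] : exists j, j \in ~: I.
  by apply/finset.set0Pn; apply: contra IT => /eqP E; rewrite -(setCK I) E setC0.
rewrite /select; case E : (enum (~: I)) => [|i s] /=.
  by have := mem_enum (~: I) j; rewrite E jI.
by rewrite (linf0 (rmul_linearl _)) scaler0.
Qed.

(** By [rebuild] a value [X (word w A)] is known from its corestriction and its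
    coproduct.  When the latter only depends on shorter words, as it does for
    cohomomorphisms and for coderivations along them, induction on the length
    shows that the corestriction determines the map. *)
Lemma linear_eq_coprod W W' (X Y : tspace W -> tspace W') :
  linear X -> linear Y -> (forall x, corestr (X x) = corestr (Y x)) ->
  (forall p (a : 'I_p -> deg n) (w : 'I_p -> W) (A : {set 'I_p}),
     (forall i, ghom (a i) (w i)) ->
     (forall B : {set 'I_p}, (#|B| < #|A|)%N -> X (word w B) = Y (word w B)) ->
     coprod (X (word w A)) = coprod (Y (word w A))) ->
  X =1 Y.
Proof.
move=> hX hY hc hind; apply: tspace_ind => [|c x y hx hy|p a w hw].
- by rewrite (linf0 hX) (linf0 hY).
- by rewrite hX hY hx hy.
have [m] := ubnP #|[set: 'I_p]%SET|; elim: m [set: 'I_p]%SET => // m IH A.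
rewrite ltnS => Am; rewrite [LHS]rebuild [RHS]rebuild hc; congr (_ + mulmap _ _ _).
apply: hind => // B BA; apply: IH; exact: leq_trans BA Am.
Qed.

Lemma coprod_letter W b (u : W) : ghom b u -> coprod (letter u) = 0.
Proof.
move=> hu; have hl : @homlist K n W [:: (b, u)].
  by move=> x; rewrite inE => /eqP ->.
rewrite (coprod_hom hl : coprod (letter u) = _) (coprod_word_rcons [::] (b, u)).
by rewrite big_pred0 // => I; apply/negbTE; rewrite negbK; apply/eqP/setP => -[].
Qed.

(** Cutting the unshuffles of [A] according to which part contains the last
    letter, the symmetrisation of the coproduct is the full unshuffle
    coproduct.  This is used both for the words [h A] and for their images
    under a cohomomorphism. *)
Lemma coprod_flip p W (a : 'I_p -> deg n) (h : {set 'I_p} -> tspace W)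
    (A : {set 'I_p}) :
  (forall B : {set 'I_p}, B \subset A -> ghom (sdeg a B) (h B)) ->
  coprod (h A) = \sum_(B | coprod_unshuffle A B)
    ukoszul K a B (A :\: B) *: (h B \ox h (A :\: B)) ->
  coprod (h A) + flip (coprod (h A)) =
    \sum_(B : {set 'I_p} |
        [&& B \subset A, B != finset.set0 & A :\: B != finset.set0])
      ukoszul K a B (A :\: B) *: (h B \ox h (A :\: B)).
Proof.
move=> hh hA; have lf := @flip_linear K n (tspace W).
have dj (B : {set 'I_p}) : [disjoint B & A :\: B].
  by rewrite disjoint_sym -setI_eq0 setIDAC setDIl setDv setI0.
rewrite hA (linf_sum _ _ _ lf).
rewrite [RHS](bigID (fun B : {set 'I_p} => hi B < hi (A :\: B))%N) /=.
congr (_ + _).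
  by apply: eq_bigl => B; rewrite /coprod_unshuffle /hi_lt -!andbA.
rewrite [RHS](reindex_onto (fun B : {set 'I_p} => A :\: B)
  (fun B : {set 'I_p} => A :\: B)) /=; last first.
  by move=> B /andP[/and3P[BA _ _] _]; rewrite setDDr setDv set0U; apply/setIidPr.
apply: eq_big => [B|B /andP[BA _]].
  rewrite /coprod_unshuffle /hi_lt setDDr setDv set0U subsetDl /=.
  have [BA|nBA] := boolP (B \subset A); last first.
    symmetry; apply/negbTE; rewrite negb_and; apply/orP; right.
    by apply: contra nBA => /eqP <-; exact: subsetIl.
  rewrite (setIidPr BA) eqxx andbT.
  case B0 : (B == finset.set0); rewrite ?andbF //=.
  case C0 : (A :\: B == finset.set0); rewrite //=.
  by rewrite -leqNgt [RHS]leq_eqVlt (negbTE (hi_neq _ _ _)) // ?B0 ?C0.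
rewrite (linfZ _ _ lf) (flip_hom (a := sdeg a B) (b := sdeg a (A :\: B))).
- by rewrite scalerA ukoszulC // setDDr setDv set0U (setIidPr BA).
- exact: hh.
- exact/hh/subsetDl.
Qed.

(** Multiplying by a last letter [u] turns every unshuffle of [x], including
    the one with empty second part, into one for [x.u]: this is the recursive
    form of the coproduct. *)
Lemma coprod_rmul W b (u : W) (x : tspace W) : ghom b u ->
  coprod (rmul u x) =
    tensor_map id 0 (rmul u : tspace W -> tspace W)
      (coprod x + flip (coprod x)) + x \ox letter u.
Proof.
move=> hu; have lc := @coprod_linear K n W; have lf := @flip_linear K n (tspace W).
have lr := rmul_linear u; have lid : linear (@id (tspace W)) by [].
have lt := tensor_map_linear (V := tspace W) (V' := tspace W) (W := tspace W)
  (W' := tspace W) 0 lid lr.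
elim/tpowers_homind: x => [|c x y hx hy|l hl].
- rewrite (linf0 lr) (linf0 lc) (linf0 lf) addr0 (linf0 lt) add0r.
  by rewrite (linf0 (tens2_linearl _)).
- rewrite lr !lc hx hy lf addrACA -scalerDr lt (tens2_linearl _ c).
  by rewrite scalerDr addrACA.
have [l0|l0] := eqVneq l [::].
  rewrite l0 /= (tens_multilinear W).1 (linf0 lr) (linf0 lc) (linf0 lf) addr0.
  by rewrite (linf0 lt) add0r (linf0 (tens2_linearl _)).
have hl' : homlist (rcons l (b, u)).
  by move=> x; rewrite mem_rcons inE => /orP[/eqP ->|/hl].
have -> : rmul u (tens [seq x.2 | x <- l]) = tens [seq x.2 | x <- rcons l (b, u)].
  by rewrite rmul_tens map_rcons; case: l l0 {hl hl'}.
rewrite coprod_hom // coprod_word_rcons -select_nth.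
set a := (fun i : 'I_(size l) => (l`_i).1).
set w := (fun i : 'I_(size l) => (l`_i).2).
have hw i : ghom (a i) (w i) by apply: hl; rewrite mem_nth.
have T0 : [set: 'I_(size l)]%SET != finset.set0.
  case: l l0 {hl hl' a w hw} => // y l _.
  by apply/finset.set0Pn; exists ord0; rewrite inE.
rewrite -/(word w _) (@coprod_flip _ _ a (word w)); last first.
- exact: coprod_unshuffles.
- by move=> B _; exact: ghom_word.
rewrite (bigD1 [set: 'I_(size l)]%SET) //= addrC; congr (_ + _); last first.
  rewrite setCT {1}/select enum_set0 /= /ukoszul big1 ?scale1r // => i _.
  by rewrite big_pred0 // => j; rewrite inE.
rewrite (linf_sum _ _ _ lt); apply: eq_big => [B|B /andP[_ BT]].
  by rewrite subsetT setTD -(inj_eq (can_inj (@setCK _)) (~: B)) setCK setC0.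
rewrite (linfZ _ _ lt) setTD tensor_map_hom0 // /word rmul_tens /rmul_word.
case E : (select w (~: B)) => //; case/negP: BT.
have := congr1 size E; rewrite size_map -cardE => /eqP.
by rewrite cards_eq0 -(inj_eq (can_inj (@setCK _)) (~: B)) setCK setC0.
Qed.

End CoproductTheory.

(** * Cohomomorphisms and their corestrictions *)

Section Cohomomorphisms.
Variables (K : fieldType) (n : nat).
Implicit Types W : gspace K n.

Section Recursion.
Variables (p : nat) (W W' : gspace K n) (a : 'I_p -> deg n) (w : 'I_p -> W).
Hypothesis hw : forall i, ghom (a i) (w i).

Lemma cohomomorphism_coprod (F : tspace W -> tspace W') (A : {set 'I_p}) :
  cohomomorphism F ->
  coprod (F (word w A)) = \sum_(B | coprod_unshuffle A B)
    ukoszul K a B (A :\: B) *: (F (word w B) \ox F (word w (A :\: B))).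
Proof.
move=> [lF _ hF]; have lt := tensor_map_linear 0 lF lF.
rewrite hF (coprod_unshuffles hw) (linf_sum _ _ _ lt); apply: eq_bigr => B _.
by rewrite (linfZ _ _ lt) tensor_map_hom0.
Qed.

(** [rebuild] for [F (word w A)].  When the recursion is unrolled, [A :\: B]
    becomes the block that contains the last letter. *)
Lemma cohomomorphism_rec (F : tspace W -> tspace W') (A : {set 'I_p}) :
  cohomomorphism F ->
  F (word w A) = letter (corestr (F (word w A))) +
    \sum_(B | coprod_unshuffle A B) ukoszul K a B (A :\: B) *:
      rmul (corestr (F (word w (A :\: B)))) (F (word w B)).
Proof.
move=> hF; have lr := @corestr_linear K W'.
have lid : linear (@id (tspace W')) by [].
have lm := mulmap_linear lid lr; rewrite [LHS]rebuild; congr (_ + _).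
rewrite (cohomomorphism_coprod _ hF) (linf_sum _ _ _ lm); apply: eq_bigr => B _.
by rewrite (linfZ _ _ lm) mulmap_tens2.
Qed.

Lemma coderivation_coprod b (Q : tspace W -> tspace W) (A : {set 'I_p}) :
  coderivation b Q ->
  coprod (Q (word w A)) = \sum_(B | coprod_unshuffle A B)
    ukoszul K a B (A :\: B) *: (Q (word w B) \ox word w (A :\: B) +
      dsign K b (sdeg a B) *: (word w B \ox Q (word w (A :\: B)))).
Proof.
move=> [lQ _ hQ]; have lid : linear (@id (tspace W)) by [].
have lt1 := tensor_map_linear 0 lQ lid; have lt2 := tensor_map_linear b lid lQ.
rewrite hQ (coprod_unshuffles hw) (linf_sum _ _ _ lt1) (linf_sum _ _ _ lt2).
rewrite -big_split; apply: eq_bigr => B _ /=.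
rewrite (linfZ _ _ lt1) (linfZ _ _ lt2) tensor_map_hom0 // -scalerDr.
by rewrite (tensor_map_hom _ _ lid lQ (ghom_word B hw)).
Qed.

Lemma coderivation_rec b (Q : tspace W -> tspace W) (A : {set 'I_p}) :
  coderivation b Q ->
  Q (word w A) = letter (corestr (Q (word w A))) +
    \sum_(B | coprod_unshuffle A B) ukoszul K a B (A :\: B) *:
      (rmul (corestr (word w (A :\: B))) (Q (word w B)) +
       dsign K b (sdeg a B) *:
         rmul (corestr (Q (word w (A :\: B)))) (word w B)).
Proof.
move=> hQ; have lr := @corestr_linear K W.
have lid : linear (@id (tspace W)) by [].
have lm := mulmap_linear lid lr; rewrite [LHS]rebuild; congr (_ + _).
rewrite (coderivation_coprod _ hQ) (linf_sum _ _ _ lm); apply: eq_bigr => B _.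
by rewrite (linfZ _ _ lm) (linfD _ _ lm) (linfZ _ _ lm) !mulmap_tens2.
Qed.

End Recursion.

Lemma cohomomorphism_eq W W' (F G : tspace W -> tspace W') :
  cohomomorphism F -> cohomomorphism G ->
  (forall x, corestr (F x) = corestr (G x)) -> F =1 G.
Proof.
move=> hF hG hc; have [[lF _ _] [lG _ _]] := (hF, hG).
apply: linear_eq_coprod => // p a w A hw IH.
rewrite !(cohomomorphism_coprod hw) //; apply: eq_bigr => B.
by move=> /coprod_unshuffle_card/andP[h1 h2]; rewrite !IH.
Qed.

(** Both [Q' \o F] and [F \o Q] are coderivations along [F], that is, their
    coproducts are given by the same formula in terms of shorter words, so they
    are determined by their corestrictions. *)
Lemma intertwine_corestr W W' b (Q : tspace W -> tspace W)
    (Q' : tspace W' -> tspace W') (F : tspace W -> tspace W') :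
  coderivation b Q -> coderivation b Q' -> cohomomorphism F ->
  (forall x, corestr (Q' (F x)) = corestr (F (Q x))) ->
  forall x, Q' (F x) = F (Q x).
Proof.
move=> hQ hQ' hF hc; have [lF wF cF] := hF; have [lQ wQ _] := hQ.
have [lQ' wQ' cQ'] := hQ'; have lid : linear (@id (tspace W')) by [].
have lt1 := tensor_map_linear 0 lQ' lid; have lt2 := tensor_map_linear b lid lQ'.
have ltF := tensor_map_linear 0 lF lF.
apply: (linear_eq_coprod (X := fun x => Q' (F x)) (Y := fun x => F (Q x))) => //.
- exact: linear_comp lF lQ'.
- exact: linear_comp lQ lF.
move=> p a w A hw IH.
rewrite cQ' (cohomomorphism_coprod hw _ hF) cF (coderivation_coprod hw _ hQ).
rewrite (linf_sum _ _ _ ltF) (linf_sum _ _ _ lt1) (linf_sum _ _ _ lt2) -big_split.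
apply: eq_bigr => B /coprod_unshuffle_card/andP[h1 h2] /=.
rewrite (linfZ _ _ lt1) (linfZ _ _ lt2) (linfZ _ _ ltF) -scalerDr; congr (_ *: _).
rewrite (linfD _ _ ltF) (linfZ _ _ ltF) !tensor_map_hom0 // IH //; congr (_ + _).
have hwF : ghom (sdeg a B) (F (word w B)).
  by rewrite -[sdeg a B]addr0; apply: wF; exact: ghom_word.
by rewrite (tensor_map_hom _ _ lid lQ' hwF) IH.
Qed.

(** ** Existence *)

Section Cofree.
Variables (W W' : gspace K n) (g : tspace W -> W').
Hypotheses (lg : linear g) (wg : has_weight 0 g).

(** The equation [F = g + (F (x) g) D], [D] the coproduct, determines [F] on
    words of length [N] from its values on shorter ones; iterating it [N] times
    from 0 gives the value on words of length at most [N]. *)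
Definition cofree_iter (N : nat) : tspace W -> tspace W' :=
  iter N (fun F x => letter (g x) + mulmap F g (coprod x)) (fun=> 0).

Definition cofree (x : tspace W) : tspace W' :=
  ulift (fun l : seq W => cofree_iter (size l) (tens l)) x.

Lemma cofree_iter_linear N : linear (cofree_iter N).
Proof.
elim: N => [|N IH] c x y /=; first by rewrite scaler0 addr0.
have lm := mulmap_linear IH lg; rewrite lg letter_linear coprod_linear lm.
by rewrite scalerDr addrACA.
Qed.

Lemma cofree_word_multilinear :
  multilinear (fun l : seq W => cofree_iter (size l) (tens l) : tspace W').
Proof.
split=> // s1 s2 c u v; rewrite !size_cat /= (tens_multilinear W).2.
exact: cofree_iter_linear.
Qed.

Lemma cofree_linear : linear cofree.
Proof. exact: ulift_linear cofree_word_multilinear. Qed.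

Section CofreeWords.
Variables (p : nat) (a : 'I_p -> deg n) (w : 'I_p -> W).
Hypothesis hw : forall i, ghom (a i) (w i).

Lemma cofree_iterS N (A : {set 'I_p}) :
  cofree_iter N.+1 (word w A) = letter (g (word w A)) +
    \sum_(B | coprod_unshuffle A B) ukoszul K a B (A :\: B) *:
      rmul (g (word w (A :\: B))) (cofree_iter N (word w B)).
Proof.
have lm := mulmap_linear (cofree_iter_linear N) lg.
rewrite /= (coprod_unshuffles hw) (linf_sum _ _ _ lm); congr (_ + _).
apply: eq_bigr => B _; rewrite (linfZ _ _ lm) mulmap_tens2 //.
exact: cofree_iter_linear.
Qed.

Lemma cofree_iter_stable N (A : {set 'I_p}) : (#|A| <= N)%N ->
  cofree_iter N (word w A) = cofree (word w A).
Proof.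
move=> AN; rewrite /cofree /word ulift_gen; last exact: cofree_word_multilinear.
rewrite size_map -cardE -/(word w A).
elim/ltn_ind: N A AN => [[|N] IH] A AN; first by move: AN; case: #|A|.
move: AN; rewrite leq_eqVlt => /orP[/eqP -> //|AN].
case Am : #|A| => [|m].
  move/eqP: Am; rewrite cards_eq0 => /eqP ->.
  by rewrite word0 (linf0 (cofree_iter_linear _)).
have mN : (m < N)%N by rewrite -ltnS -Am.
rewrite !cofree_iterS; congr (_ + _); apply: eq_bigr => B.
move=> /coprod_unshuffle_card/andP[h1 _]; congr (_ *: rmul _ _).
have Bm : (#|B| <= m)%N by rewrite -ltnS -Am.
by rewrite (IH N) ?(leq_trans Bm (ltnW mN)) // (IH m) // ltnW.
Qed.

Lemma cofree_rec (A : {set 'I_p}) :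
  cofree (word w A) = letter (g (word w A)) +
    \sum_(B | coprod_unshuffle A B) ukoszul K a B (A :\: B) *:
      rmul (g (word w (A :\: B))) (cofree (word w B)).
Proof.
rewrite -(@cofree_iter_stable #|A|.+1) ?leqnSn // cofree_iterS; congr (_ + _).
apply: eq_bigr => B /coprod_unshuffle_card/andP[h1 _].
by rewrite cofree_iter_stable // ltnW.
Qed.

Lemma ghom_cofree (A : {set 'I_p}) : ghom (sdeg a A) (cofree (word w A)).
Proof.
have [m] := ubnP #|A|; elim: m A => // m IH A Am; rewrite cofree_rec.
have hg B : ghom (sdeg a B) (g (word w B)).
  by rewrite -[sdeg a B]addr0; apply: wg; exact: ghom_word.
apply: ghom_add; first exact: letter_weight.
apply: ghom_sum => B hB; apply: ghomZ.
have -> : sdeg a A = sdeg a B + sdeg a (A :\: B).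
  by case/andP: hB => BA _; rewrite /sdeg (big_setID B) (setIidPr BA).
apply: rmul_weight => //; apply: IH.
by case/andP: (coprod_unshuffle_card hB) => h _; rewrite -ltnS (leq_trans _ Am).
Qed.

Lemma corestr_cofree (A : {set 'I_p}) :
  corestr (cofree (word w A)) = g (word w A).
Proof.
have lr := @corestr_linear K W'.
rewrite cofree_rec (linfD _ _ lr) corestr_letter (linf_sum _ _ _ lr).
rewrite big1 ?addr0 // => B _; rewrite (linfZ _ _ lr).
by rewrite corestr_rmul scaler0.
Qed.

(** Induction on the length.  Expanding the left-hand side by [cofree_rec], then
    every product by [coprod_rmul] and the induction hypothesis, gives a sum over
    the partitions of [A] into three parts [C], [D] and [E], the last letter
    lying in [E]; [C] makes up the first tensor factor.  Expanding the second
    factors on the right-hand side by [cofree_rec] gives the same sum. *)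
Lemma coprod_cofree (A : {set 'I_p}) :
  coprod (cofree (word w A)) = \sum_(B | coprod_unshuffle A B)
    ukoszul K a B (A :\: B) *: (cofree (word w B) \ox cofree (word w (A :\: B))).
Proof.
have [m] := ubnP #|A|; elim: m A => // m IH A Am.
have lc := @coprod_linear K n W'; have lid : linear (@id (tspace W')) by [].
rewrite {1}cofree_rec (linfD _ _ lc) (linf_sum _ _ _ lc).
rewrite (coprod_letter (b := sdeg a A)) ?add0r; last first.
  by rewrite -[sdeg a A]addr0; apply: wg; exact: ghom_word.
pose G B := g (word w B); pose F B := cofree (word w B).
have hG B : ghom (sdeg a B) (G B).
  by rewrite -[sdeg a B]addr0; apply: wg; exact: ghom_word.
have -> : \sum_(B | coprod_unshuffle A B)
    coprod (ukoszul K a B (A :\: B) *: rmul (G (A :\: B)) (F B)) =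
  \sum_(B | coprod_unshuffle A B)
    \sum_(C : {set 'I_p} | [&& C \subset B, C != finset.set0 & B :\: C != finset.set0])
      (ukoszul K a B (A :\: B) * ukoszul K a C (B :\: C)) *:
         (F C \ox rmul (G (A :\: B)) (F (B :\: C))) +
  \sum_(B | coprod_unshuffle A B)
    ukoszul K a B (A :\: B) *: (F B \ox letter (G (A :\: B))).
  rewrite -big_split; apply: eq_bigr => B hB /=.
  have /andP[BA _] := coprod_unshuffle_card hB.
  have lr := rmul_linear (G (A :\: B)).
  have lt := tensor_map_linear (V := tspace W') (V' := tspace W')
    (W := tspace W') (W' := tspace W') 0 lid lr.
  rewrite (linfZ _ _ lc) (coprod_rmul _ (hG _)) scalerDr; congr (_ + _).
  rewrite (@coprod_flip _ _ _ _ a F); last first.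
  - by apply: IH; rewrite -ltnS (leq_trans _ Am).
  - by move=> C _; exact: ghom_cofree.
  rewrite (linf_sum _ _ _ lt) scaler_sumr; apply: eq_bigr => C _.
  by rewrite (linfZ _ _ lt) tensor_map_hom0 // scalerA.
rewrite [RHS](eq_bigr (fun C => ukoszul K a C (A :\: C) *:
    (F C \ox letter (G (A :\: C))) +
   \sum_(B | coprod_unshuffle (A :\: C) B)
     (ukoszul K a C (A :\: C) * ukoszul K a B ((A :\: C) :\: B)) *:
     (F C \ox rmul (G ((A :\: C) :\: B)) (F B)))); last first.
  move=> C _; rewrite -/(F C) [cofree (word w (A :\: C))]cofree_rec.
  have l2 := tens2_linearr (V := tspace W') (F C).
  rewrite (linfD _ _ l2) scalerDr (linf_sum _ _ _ l2) scaler_sumr.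
  congr (_ + _); apply: eq_bigr => B _.
  by rewrite (linfZ _ _ l2) scalerA.
rewrite big_split addrC; congr (_ + _).
(* Here [B] is the union of [C] and [D]. *)
rewrite (exchange_big_dep (coprod_unshuffle A)) /=; last first.
  by move=> B C hB /and3P[CB C0 _]; exact: coprod_unshuffleW hB CB C0.
apply: eq_bigr => C hC.
rewrite (reindex_onto (fun D : {set 'I_p} => C :|: D)
  (fun B : {set 'I_p} => B :\: C)) /=; last first.
  by move=> B /andP[_ /and3P[CB _ _]]; rewrite setDE setUIr setUCr setIT;
    exact/setUidPr.
have [CA /and3P[C0 _ _]] := andP hC.
have UDC D : ((C :|: D) :\: C == D) = [disjoint C & D].
  rewrite setDUl setDv set0U; apply/eqP/idP => [<-|CD].
    by rewrite disjoint_sym -setI_eq0 setIDAC setDIl setDv setI0.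
  by apply/setDidPl; rewrite disjoint_sym.
apply: eq_big => [D|D].
  rewrite coprod_unshuffle_assoc // UDC subsetUl C0 /= -!andbA; congr (_ && _).
  case CD: [disjoint C & D]; rewrite ?andbF // andbT.
  by have := UDC D; rewrite CD => /eqP ->; rewrite andbT.
case/andP=> /andP[hB _]; rewrite UDC => CD.
have := UDC D; rewrite CD => /eqP ->; rewrite setDDl; congr (_ *: _).
have BA : C :|: D \subset A by case/andP: hB.
have DAC : D \subset A :\: C.
  by rewrite subsetD (fintype.subset_trans (subsetUr _ _) BA) disjoint_sym.
have -> : A :\: C = D :|: (A :\: (C :|: D)).
  by rewrite -[LHS](setID _ D) (setIidPr DAC) setDDl.
have dE (B E : {set 'I_p}) : B \subset E -> [disjoint B & A :\: E].
  move=> BE; rewrite -setI_eq0 setIC; apply/eqP/disjoint_setI0.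
  by apply: disjointWr BE _; rewrite -setI_eq0 setIDAC setDIl setDv setI0.
rewrite ukoszulUl // ukoszulUr ?dE ?subsetUr //.
by rewrite mulrC mulrA.
Qed.

End CofreeWords.
Lemma corestr_cofreeE x : corestr (cofree x) = g x.
Proof.
have lr := @corestr_linear K W'; have lF := cofree_linear.
elim/tspace_ind: x => [|c x y hx hy|p a w hw]; last exact: corestr_cofree hw _.
- by rewrite (linf0 lF) (linf0 lr) (linf0 lg).
- by rewrite lF lr hx hy lg.
Qed.

Lemma cofree_cohomomorphism : cohomomorphism cofree.
Proof.
have lF := cofree_linear; have lt := tensor_map_linear 0 lF lF.
have lc := @coprod_linear K n; split=> //.
  apply: has_weight_words => // l hl; have [p [a [w [hw -> ->]]]] := homlist_word hl.
  rewrite addr0; exact: ghom_cofree.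
apply: tspace_ind => [|c x y hx hy|p a w hw].
- by rewrite (linf0 lF) !(linf0 (lc _)) (linf0 lt).
- by rewrite lF !lc hx hy lt.
rewrite (coprod_cofree hw) (coprod_unshuffles hw) (linf_sum _ _ _ lt).
by apply: eq_bigr => B _; rewrite (linfZ _ _ lt) tensor_map_hom0.
Qed.

End Cofree.
End Cohomomorphisms.

(** * Explicit formulas *)

Section OrderedUnshuffles.
Variable p : nat.
Implicit Types (A B D : {set 'I_p}) (t : seq {set 'I_p}).

(** [ordered_unshuffles], for the partitions of any subset [A]. *)
Definition ordered_blocks A t : bool :=
  [&& all (fun B => B != finset.set0) t,
      pairwise (fun B D => B :&: D == finset.set0) t,
      (\bigcup_(B <- t) B)%SET == A & sorted ltn (map (@hi p) t)].

Lemma in_bigcup_seq t i : (i \in (\bigcup_(B <- t) B)%SET) = has (fun B => i \in B) t.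
Proof. by elim: t => [|B t IH]; rewrite ?big_nil ?big_cons ?inE //= IH. Qed.

Lemma bigcup_seq_neq0 t : t != [::] -> all (fun B => B != finset.set0) t ->
  (\bigcup_(B <- t) B)%SET != finset.set0.
Proof.
case: t => //= B t _ /andP[/finset.set0Pn[i iB] _]; apply/finset.set0Pn; exists i.
by rewrite in_bigcup_seq /= iB.
Qed.

Lemma flatten_blocks A t : ordered_blocks A t ->
  perm_eq (flatten [seq enum B | B : {set 'I_p} <- t]) (enum A).
Proof.
case/and4P=> _ pt /eqP <- _; apply: uniq_perm; last first.
- move=> i; rewrite mem_enum in_bigcup_seq.
  by elim: t {pt} => //= B t IH; rewrite mem_cat IH mem_enum.
- exact: enum_uniq.
elim: t pt => //= B t IH /andP[Bt /IH ut]; rewrite cat_uniq enum_uniq ut andbT.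
apply/hasPn => i; elim: t Bt {IH ut} => //= D t IH /andP[/eqP BD /IH h].
rewrite mem_cat mem_enum => /orP[iD|/h //]; rewrite mem_enum /=.
by apply/negP => iB; move/setP/(_ i): BD; rewrite !inE iB iD.
Qed.

Lemma ordered_blocks1 A D : ordered_blocks A [:: D] = (D == A) && (A != finset.set0).
Proof.
rewrite /ordered_blocks /= big_seq1 !andbT.
by have [->|] := eqVneq D A; rewrite ?andbT ?andbF.
Qed.

(** In an ordered partition the last block [D] contains the last element of [A].
    Removing it is therefore an unshuffle of the coproduct, with an ordered
    partition of its first part; this is the pattern of [cohomomorphism_rec]. *)
Lemma ordered_blocks_rcons A t D : t != [::] ->
  ordered_blocks A (rcons t D) =
  [&& D \subset A, coprod_unshuffle A (A :\: D) & ordered_blocks (A :\: D) t].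
Proof.
move=> t0; rewrite /ordered_blocks all_rcons pairwise_rcons map_rcons.
rewrite !(sorted_pairwise ltn_trans) pairwise_rcons all_map -cats1 big_cat big_seq1 /=.
set U := (\bigcup_(B <- t) B)%SET.
have UD : all (fun B => B :&: D == finset.set0) t = (U :&: D == finset.set0).
  apply/allP/eqP => [h|h B Bt].
    apply/setP => i; rewrite !inE in_bigcup_seq; apply/andP => -[/hasP[B Bt iB] iD].
    by have /eqP/setP/(_ i) := h B Bt; rewrite !inE iB iD.
  apply/eqP/setP => i; rewrite !inE; apply/andP => -[iB iD].
  move/setP/(_ i): h; rewrite !inE iD andbT in_bigcup_seq => /hasPn/(_ B Bt).
  by rewrite iB.
have hU : all (fun B => hi B < hi D)%N t = (hi U < hi D)%N.
  rewrite /U; case: t t0 {UD U} => // B t _; elim: t B => [|C t IH] B.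
    by rewrite /= big_seq1 andbT.
  by rewrite /= big_cons hiU gtn_max -IH.
rewrite (_ : all (preim _ _) t = (hi U < hi D)%N) // UD.
case at0 : (all _ t); rewrite ?andbF //=.
have U0 : U != finset.set0.
  exact: bigcup_seq_neq0.
case pt : (pairwise _ t); rewrite ?andbF //=.
case st : (pairwise ltn _); rewrite ?andbF //= !andbT.
have [DA|nDA] := boolP (D \subset A); last first.
  apply/negbTE; apply: contra nDA => /and4P[_ _ /eqP <- _]; exact: subsetUr.
have [UE|UE] /= := eqVneq U (A :\: D); last first.
  rewrite andbF; apply/negbTE; apply: contra UE => /and4P[_ /eqP dUD /eqP <- _].
  rewrite setDUl setDv setU0; apply/eqP; symmetry; apply/setDidPl.
  by rewrite -setI_eq0 dUD.
rewrite andbT UE.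
have -> : (A :\: D) :&: D = finset.set0 by rewrite setIDAC -setIDA setDv setI0.
have -> : A :\: D :|: D = A by rewrite setUC -[RHS](setID A D) (setIidPr DA).
rewrite !eqxx /= /coprod_unshuffle /hi_lt subsetDl -UE U0 UE.
by rewrite setDDr setDv set0U (setIidPr DA).
Qed.

End OrderedUnshuffles.

Section CohomomorphismFormula.
Variables (K : fieldType) (n : nat) (W W' : gspace K n).
Variables (p : nat) (a : 'I_p -> deg n) (w : 'I_p -> W).
Hypothesis hw : forall i, ghom (a i) (w i).
Variable F : tspace W -> tspace W'.
Hypothesis hF : cohomomorphism F.
Let f (B : {set 'I_p}) : W' := corestr (F (word w B)).

Definition block_sum (s : nat) (A : {set 'I_p}) : tspace W' :=
  \sum_(I : s.-tuple {set 'I_p} | ordered_blocks A I)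
    koszul K a (flatten [seq enum B | B : {set 'I_p} <- I]) *:
    tens [seq corestr (F (word w B)) | B : {set 'I_p} <- I].

Lemma block_sum1 A : block_sum 1 A = letter (f A).
Proof.
have lF : linear F by case: hF.
rewrite /block_sum; have [->|A0] := eqVneq A finset.set0.
  rewrite big_pred0 => [|I]; last first.
    by case: I => -[//|D [|//]] sz; rewrite /= ordered_blocks1 eqxx andbF.
  by rewrite /f word0 (linf0 lF) (linf0 (@corestr_linear _ _))
    (linf0 (@letter_linear _ _)).
rewrite (big_pred1 [tuple A]) => [|I].
  by rewrite /= cats0 koszul_sorted ?scale1r // sorted_enum.
case: I => -[//|D [|//]] sz; rewrite /= ordered_blocks1 A0 andbT.
by apply/eqP/eqP => [DA|/(congr1 val) [//]]; apply/val_inj; rewrite /= DA.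
Qed.

Lemma block_sumS s A : block_sum s.+2 A =
  \sum_(B | coprod_unshuffle A B) ukoszul K a B (A :\: B) *:
    rmul (f (A :\: B)) (block_sum s.+1 B).
Proof.
rewrite /block_sum.
(* A tuple of blocks is given by its last entry and the tuple of the others. *)
pose h (x : s.+1.-tuple {set 'I_p} * {set 'I_p}) := [tuple of rcons x.1 x.2].
pose h' (I : s.+2.-tuple {set 'I_p}) :=
  ([tuple of belast (thead I) (behead I)], last (thead I) (behead I)).
have hK : cancel h' h.
  by move=> I; apply/val_inj; rewrite /= -lastI [in RHS](tuple_eta I).
have h'K : cancel h h'.
  move=> [t D]; rewrite /h' /h; case/tupleP: t => x t; rewrite /thead (tnth_nth x).
  congr (_, _) => /=; last by rewrite last_rcons.
  by apply/val_inj; rewrite /= belast_rcons.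
rewrite (reindex h) /=; last by exists h' => x _; [exact: h'K | exact: hK].
rewrite (eq_bigr (fun B => \sum_(t : s.+1.-tuple {set 'I_p} | ordered_blocks B t)
  (ukoszul K a B (A :\: B) *
   koszul K a (flatten [seq enum C | C : {set 'I_p} <- t])) *:
  rmul (f (A :\: B)) (tens [seq f C | C : {set 'I_p} <- t]))); last first.
  move=> B _; rewrite (linf_sum _ _ _ (rmul_linear _)) scaler_sumr.
  by apply: eq_bigr => t _; rewrite (linfZ _ _ (rmul_linear _)) scalerA.
rewrite pair_big_dep /=.
rewrite [RHS](reindex_onto (fun x => (A :\: x.2, x.1))
  (fun x => (x.2, A :\: x.1))) /=; last first.
  move=> [B t] /= /andP[/andP[BA _] _].
  by rewrite setDDr setDv set0U (setIidPr BA).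
have t0 (t : s.+1.-tuple {set 'I_p}) : tval t != [::].
  by rewrite -size_eq0 size_tuple.
apply: eq_big => [[t D]|[t D]] /=.
  rewrite ordered_blocks_rcons // xpair_eqE eqxx /= setDDr setDv set0U.
  have -> : (A :&: D == D) = (D \subset A) by apply/eqP/idP => /setIidPr.
  by rewrite andbC -andbA.
rewrite ordered_blocks_rcons // => /and3P[DA hB ot].
rewrite setDDr setDv set0U (setIidPr DA) map_rcons flatten_rcons koszul_cat.
rewrite (koszul_sorted K a (sorted_enum D)) mulr1 map_rcons rmul_tens.
have -> : rmul_word (f D) [seq f C | C : {set 'I_p} <- t] =
  tens (rcons [seq f C | C : {set 'I_p} <- t] (f D)).
  by case: (tval t) (t0 t).
congr (_ *: _); rewrite mulrC; congr (_ * _).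
rewrite (perm_big _ (flatten_blocks ot)) big_enum /=; apply: eq_bigr => i _.
by rewrite big_enum_cond.
Qed.

(** The number of blocks is bounded by an arbitrary [N], not by [#|A|], because
    the induction passes from [A] to subsets of varying size. *)
Lemma cohomomorphism_blocks N (A : {set 'I_p}) : (#|A| <= N)%N ->
  F (word w A) = \sum_(1 <= s < N.+1) block_sum s A.
Proof.
have lF : linear F by case: hF.
elim: N A => [|N IH] A AN.
  move: AN; rewrite leqn0 cards_eq0 => /eqP ->.
  by rewrite word0 (linf0 lF) big_geq.
rewrite (cohomomorphism_rec hw _ hF) big_ltn // block_sum1.
congr (_ + _); rewrite big_add1 /=.
rewrite [RHS](eq_big_nat _ _ (F2 := fun s => \sum_(B | coprod_unshuffle A B)
  ukoszul K a B (A :\: B) *: rmul (f (A :\: B)) (block_sum s B))); last first.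
  by case=> [//|s] _; exact: block_sumS.
rewrite exchange_big /=; apply: eq_bigr => B.
move=> /coprod_unshuffle_card/andP[BA _]; rewrite (IH B); last first.
  by rewrite -ltnS (leq_trans BA AN).
rewrite (linf_sum _ _ _ (rmul_linear _)) scaler_sumr //.
Qed.

End CohomomorphismFormula.

Section Prefixes.
Variable p : nat.

Definition prefix_set (k : nat) : {set 'I_p} := [set i : 'I_p | (i < k)%N].
Definition between (j k : nat) : {set 'I_p} := [set i : 'I_p | (j < i < k)%N].

Lemma prefix_setS (m : 'I_p) : prefix_set m.+1 = m |: prefix_set m.
Proof. by apply/setP => i; rewrite !inE ltnS leq_eqVlt. Qed.

Lemma enum_betweenS (j : nat) (m : 'I_p) : (j < m)%N ->
  enum (between j m.+1) = rcons (enum (between j m)) m.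
Proof.
move=> jm; apply: enum_sortedE => [|i]; last first.
  by rewrite mem_rcons inE mem_enum !inE -val_eqE /=; move: jm; lia.
have := sorted_enum (between j m); case E : (enum _) => [//|i s] /= ps.
rewrite rcons_path ps; have : last i s \in between j m.
  by rewrite -mem_enum E mem_last.
by rewrite inE => /andP[].
Qed.

Lemma enum_suffix (j : 'I_p) : enum (~: prefix_set j) = j :: enum (between j p).
Proof.
apply: enum_sortedE => [|i]; last first.
  by rewrite inE mem_enum !inE -val_eqE /=; have := ltn_ord i; lia.
rewrite /= path_sortedE; last exact: ltI_trans.
by rewrite sorted_enum andbT; apply/allP => i; rewrite mem_enum inE => /andP[].
Qed.

Lemma suffix_inj (i j : 'I_p) : (~: prefix_set i == ~: prefix_set j) = (j == i).
Proof.
apply/eqP/eqP => [E|-> //]; apply/val_inj/eqP; rewrite eqn_leq /=.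
move/setP: E => E; have := E i; have := E j; rewrite !inE !ltnn /=; lia.
Qed.

Lemma split_unshuffles_suffix (I J L : {set 'I_p}) :
  split_unshuffles I J L -> exists j : 'I_p, L = ~: prefix_set j.
Proof.
case/and4P=> L0 _ _ /and3P[_ /eqP IJL /andP[/forall_inP hI /forall_inP hJ]].
case E : (enum L) => [|j s].
  by move/eqP: (congr1 size E); rewrite -cardE cards_eq0 (negbTE L0).
have jL : j \in L by rewrite -mem_enum E inE eqxx.
exists j; apply/setP => i; rewrite !inE -leqNgt.
have := sorted_enum L; rewrite E /= path_sortedE; last exact: ltI_trans.
case/andP=> /allP hs _; apply/idP/idP => [|ji].
  by rewrite -mem_enum E inE => /orP[/eqP -> //|/hs /ltnW].
have := in_setT i; rewrite -IJL !inE => /orP[/orP[iI|iJ]|//].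
- by have /forall_inP/(_ j jL) := hI i iI; rewrite ltnNge ji.
- by have /forall_inP/(_ j jL) := hJ i iJ; rewrite ltnNge ji.
Qed.

Lemma split_unshuffles_prefix (j : 'I_p) (I J : {set 'I_p}) :
  split_unshuffles I J (~: prefix_set j) =
  (I \subset prefix_set j) && (J == prefix_set j :\: I).
Proof.
have jP : j \in ~: prefix_set j by rewrite !inE ltnn.
apply/idP/andP.
  case/and4P=> _ /eqP IJ _ /and3P[_ /eqP IJL /andP[/forall_inP hI /forall_inP hJ]].
  have sI : I \subset prefix_set j.
    by apply/subsetP => i iI; have /forall_inP/(_ j jP) := hI i iI; rewrite inE.
  split=> //; apply/eqP/setP => i; rewrite !inE; apply/idP/andP => [iJ|[iI ij]].
    split; last by have /forall_inP/(_ j jP) := hJ i iJ.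
    by apply/negP => iI; move/setP/(_ i): IJ; rewrite !inE iI iJ.
  have := in_setT i; rewrite -IJL !inE (negbTE iI) => /orP[//|].
  by rewrite ij.
case=> sI /eqP ->; apply/and4P; split.
- by apply/finset.set0Pn; exists j.
- by apply/eqP/setP => i; rewrite !inE; case: (i \in I).
- apply/eqP/setP => i; rewrite !inE; apply/andP => -[/(subsetP sI)].
  by rewrite inE => ->.
apply/and3P; split.
- by apply/eqP/setP => i; rewrite !inE; case: (i \in I); case: ltnP.
- apply/eqP/setP => i; rewrite !inE; case iI: (i \in I) => //=.
  by case: ltnP.
apply/andP; split; apply/forall_inP => i iI; apply/forall_inP => k;
  rewrite !inE -leqNgt; apply: leq_trans.
  by have := subsetP sI i iI; rewrite inE.
by move: iI; rewrite !inE => /andP[].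
Qed.

(** The third part of a split unshuffle is a final segment, so a split unshuffle
    amounts to the first element [j] of that part and a subset of the letters
    before [j]. *)
Lemma sum_split_unshuffles (M : nmodType)
    (T : {set 'I_p} -> {set 'I_p} -> {set 'I_p} -> M) :
  \sum_(I : {set 'I_p}) \sum_(J : {set 'I_p})
    \sum_(L : {set 'I_p} | split_unshuffles I J L) T I J L =
  \sum_(j < p) \sum_(I : {set 'I_p} | I \subset prefix_set j)
    T I (prefix_set j :\: I) (~: prefix_set j).
Proof.
transitivity (\sum_(I : {set 'I_p}) \sum_(J : {set 'I_p}) \sum_(j < p)
    \sum_(L : {set 'I_p} | split_unshuffles I J L && (L == ~: prefix_set j)) T I J L).
  apply: eq_bigr => I _; apply: eq_bigr => J _.
  rewrite (exchange_big_dep (split_unshuffles I J)) /=; last by move=> j L _ /andP[].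
  apply: eq_bigr => L hL; have [j Lj] := split_unshuffles_suffix hL.
  rewrite (big_pred1 j) // => i; by rewrite hL Lj suffix_inj.
under eq_bigr => I _ do rewrite exchange_big /=.
rewrite exchange_big /=; apply: eq_bigr => j _.
rewrite [RHS]big_mkcond /=; apply: eq_bigr => I _.
transitivity (\sum_(J : {set 'I_p} | split_unshuffles I J (~: prefix_set j))
    T I J (~: prefix_set j)).
  rewrite [RHS]big_mkcond; apply: eq_bigr => J _ /=; case: ifP => h.
    rewrite (big_pred1 (~: prefix_set j)) // => L.
    by rewrite /=; case: eqP => [->|]; rewrite ?andbF ?h.
  by rewrite big_pred0 // => L; case: eqP => [->|]; rewrite ?andbF ?h.
case: ifP => sI; last first.
  by rewrite big_pred0 // => J; rewrite split_unshuffles_prefix sI.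
by rewrite (big_pred1 (prefix_set j :\: I)) // => J;
  rewrite split_unshuffles_prefix sI.
Qed.

End Prefixes.

Section CoderivationFormula.
Variables (K : fieldType) (n : nat) (W : gspace K n).
Variables (p : nat) (a : 'I_p -> deg n) (w : 'I_p -> W).
Hypothesis hw : forall i, ghom (a i) (w i).
Variables (b : deg n) (Q : tspace W -> tspace W).
Hypothesis hQ : coderivation b Q.

Lemma corestr_long_word (A : {set 'I_p}) : (1 < #|A|)%N -> corestr (word w A) = 0.
Proof.
rewrite /word corestr_tens /select cardE.
by case: (enum A) => [|i [|j s]].
Qed.

(** In [coderivation_rec] for a prefix, the terms that apply [Q] to the first
    factor only survive when the second factor is the last letter; their sum is
    the value on the shorter prefix followed by that letter.  So induction stays
    among prefixes, and the last letter of the block on which [Q] acts runs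
    through the whole word. *)
Lemma coderivation_prefix k : (k <= p)%N ->
  Q (word w (prefix_set p k)) =
  \sum_(j < p | (j < k)%N) \sum_(I : {set 'I_p} | I \subset prefix_set p j)
    (ukoszul K a I (prefix_set p j :\: I) * dsign K b (sdeg a I)) *:
    tens (select w I ++
          corestr (Q (word w (j |: (prefix_set p j :\: I)))) ::
          select w (between p j k)).
Proof.
have [lQ _ _] := hQ; have lc := @corestr_linear K W.
elim: k => [|k IH] kp.
  have -> : prefix_set p 0 = finset.set0 by apply/setP => i; rewrite !inE.
  by rewrite big_pred0 // word0 (linf0 lQ).
pose m := Ordinal kp; have kE : k = m by [].
have mA : m \notin prefix_set p k by rewrite inE ltnn.
have ltm i : i \in prefix_set p k -> (i < m)%N by rewrite inE.
rewrite (coderivation_rec hw _ hQ) kE prefix_setS -kE.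
rewrite (eq_bigl _ _ (fun B => coprod_unshuffleU B mA ltm)).
have mB (B : {set 'I_p}) : B \subset prefix_set p k ->
    (m |: prefix_set p k) :\: B = m |: (prefix_set p k :\: B).
  move=> BA; rewrite setDUl; congr (_ :|: _); apply/setDidPl.
  rewrite disjoints1; apply: contra mA; exact: subsetP.
have uE (B : {set 'I_p}) : B \subset prefix_set p k ->
    ukoszul K a B (m |: (prefix_set p k :\: B)) = ukoszul K a B (prefix_set p k :\: B).
  move=> BA; rewrite ukoszulUr; last by rewrite disjoints1 !inE ltnn andbF.
  rewrite [X in X * _]/ukoszul big1 ?mul1r // => i iB; rewrite big_pred0 // => j.
  rewrite inE; case: eqP => //= ->; apply/negbTE; rewrite -leqNgt ltnW //.
  exact: ltm (subsetP BA i iB).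
rewrite (eq_bigr (fun B : {set 'I_p} => ukoszul K a B (prefix_set p k :\: B) *:
    rmul (corestr (word w (m |: (prefix_set p k :\: B)))) (Q (word w B)) +
    (ukoszul K a B (prefix_set p k :\: B) * dsign K b (sdeg a B)) *:
    rmul (corestr (Q (word w (m |: (prefix_set p k :\: B))))) (word w B)));
  last by move=> B /andP[BA _]; rewrite mB // uE // scalerDr scalerA.
rewrite big_split /= addrCA.
have -> : \sum_(B : {set 'I_p} | (B \subset prefix_set p k) && (B != finset.set0))
    ukoszul K a B (prefix_set p k :\: B) *:
    rmul (corestr (word w (m |: (prefix_set p k :\: B)))) (Q (word w B)) =
    rmul (w m) (Q (word w (prefix_set p k))).
  have [E0|P0] := eqVneq (prefix_set p k) finset.set0.
    rewrite E0 word0 (linf0 lQ) (linf0 (rmul_linear _)) big_pred0 // => B.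
    by rewrite subset0; case: eqP.
  rewrite (bigD1 (prefix_set p k)) ?subxx //= big1 ?addr0 => [|B].
    rewrite setDv setU0 /ukoszul big1 ?scale1r => [|i _]; last first.
      by rewrite big_pred0 // => j; rewrite inE.
    by rewrite {1}/word /select enum_set1 corestr_tens.
  case/andP=> /andP[BA _] BP; rewrite corestr_long_word.
    by rewrite (linf0 (rmul_linearl _)) scaler0.
  rewrite cardsU1 !inE ltnn andbF addnC addn1 ltnS card_gt0.
  by rewrite setD_eq0; apply: contra BP => PB; rewrite eqEsubset BA.
rewrite (bigD1 m) //= ?ltnSn // [RHS]addrC; congr (_ + _); last first.
  have -> : between p m k.+1 = finset.set0.
    by apply/setP => i; rewrite !inE /=; lia.
  have sel0 : select w finset.set0 = [::] by rewrite /select enum_set0.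
  rewrite [RHS](bigD1 finset.set0) ?sub0set //= ukoszul0l /sdeg big_set0.
  rewrite dsign0r mulr1 scale1r setD0 sel0 /=; congr (_ + _).
  apply: eq_bigr => B /andP[_ B0]; rewrite /word rmul_tens /rmul_word cats1.
  case E : (select w B) => //; move/(congr1 size): E.
  by rewrite size_map -cardE => /eqP; rewrite cards_eq0 (negbTE B0).
rewrite IH; last exact: ltnW.
rewrite (linf_sum _ _ _ (rmul_linear _)).
apply: eq_big => [j|j jk].
  by rewrite ltnS [(j <= k)%N]leq_eqVlt -val_eqE /=; lia.
rewrite (linf_sum _ _ _ (rmul_linear _)); apply: eq_bigr => I _.
rewrite (linfZ _ _ (rmul_linear _)) rmul_tens.
have -> : select w (between p j k.+1) = rcons (select w (between p j k)) (w m).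
  by rewrite /select kE enum_betweenS // map_rcons.
by rewrite -rcons_cons -rcons_cat; case: (select w I).
Qed.
End CoderivationFormula.

(** * Desuspension *)

Local Notation xorall s := (\big[addb/false]_(b <- s) b).

Section Desuspension.
Variables (K : fieldType) (n : nat).
Implicit Types V : gspace K n.

Definition par1 (d : deg n) : bool := par (d 0 0).

Lemma par1D (b c : deg n) : par1 (b + c) = par1 b (+) par1 c.
Proof. by rewrite /par1 mxE parD. Qed.

Lemma par1N (b : deg n) : par1 (- b) = par1 b.
Proof. by rewrite /par1 mxE parN. Qed.

Lemma par1_0 : par1 0 = false.
Proof. by rewrite /par1 mxE. Qed.

Lemma par1_e1 : par1 e1 = true.
Proof. by rewrite /par1 mxE. Qed.

Lemma par1_sum (I : Type) (r : seq I) (P : pred I) (F : I -> deg n) :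
  par1 (\sum_(i <- r | P i) F i) = \big[addb/false]_(i <- r | P i) par1 (F i).
Proof. by apply: (big_morph par1) => [b c|]; rewrite ?par1D ?par1_0. Qed.

Lemma par1Mn (b : deg n) k : par1 (b *+ k) = odd k && par1 b.
Proof.
elim: k => [|k IH]; first by rewrite mulr0n par1_0.
by rewrite mulrS par1D IH /=; case: (odd k); case: (par1 b).
Qed.

Lemma dot_e1 (b : deg n) : dot e1 b = b 0 0.
Proof.
rewrite /dot (bigD1 ord0) //= big1 ?addr0 => [|i i0]; first by rewrite mxE mul1r.
by rewrite mxE (negbTE i0) mul0r.
Qed.

Lemma par_dot_e1 k (b : deg n) : par (dot (e1 *+ k) b) = odd k && par1 b.
Proof.
elim: k => [|k IH]; first by rewrite mulr0n dot0l.
by rewrite mulrS dotDl parD IH dot_e1 -/(par1 b) /=; case: (odd k); case: (par1 b).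
Qed.

Lemma ksignK V b : involutive (@ksign K n V b).
Proof.
move=> v; have [s us hs] := finite_cover (gproj_finite v).
have E : v = \sum_(a <- s) gproj V a v by rewrite -[LHS]gproj_sum (fsumE us).
have lk := @ksign_linear K n V b.
rewrite {1}E !(linf_sum _ _ _ lk) [RHS]E; apply: eq_bigr => a _.
have ha : ghom a (gproj V a v) by rewrite /ghom gproj_proj eqxx.
by rewrite (ksign_hom _ ha) (linfZ _ _ lk) (ksign_hom _ ha) scalerA dsign_sqr scale1r.
Qed.

(** The signed letters of [down_tensor], for a word followed by [k] further
    letters: counting the letters to the right makes the definition recursive and
    compatible with concatenation. *)
Fixpoint alternate V (k : nat) (w : seq V) : seq V :=
  if w is v :: w' then ksign (e1 *+ (size w' + k)) v :: alternate k w' else [::].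

Lemma size_alternate V k (w : seq V) : size (alternate k w) = size w.
Proof. by elim: w => //= v w ->. Qed.

Lemma alternate_cat V k (w1 w2 : seq V) :
  alternate k (w1 ++ w2) = alternate (size w2 + k) w1 ++ alternate k w2.
Proof. by elim: w1 => //= v w1 ->; rewrite size_cat addnA. Qed.

Lemma alternateK V k : involutive (@alternate V k).
Proof. by elim=> //= v w ->; rewrite size_alternate ksignK. Qed.

Lemma alternate_multilinear V (M : lmodType K) (f : seq V -> M) k :
  multilinear f -> multilinear (fun w => f (alternate k w)).
Proof.
move=> [f0 hf]; split=> // s1 s2 c u v.
by rewrite !alternate_cat /= ksign_linear hf.
Qed.

Lemma down_tensorE V (w : seq V) :
  down_tensor w = tens (alternate 0 w : seq (desusp V)).
Proof.
rewrite /down_tensor /down; congr tens; elim: w => //= v w IH.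
rewrite addn0 subn1 /= -IH (iotaDl 1 0) -map_comp.
by congr (_ :: _); apply: eq_map => i /=; rewrite add0n subSS.
Qed.

(** The exponent of the sign of [down_tensor] on a word of homogeneous letters,
    as a function of the list of the parities of [<e_1, v>] for its letters
    [v]. *)
Fixpoint desusp_parity (s : seq bool) : bool :=
  if s is b :: s' then (odd (size s') && b) (+) desusp_parity s' else false.

Lemma desusp_parity_cat s t : desusp_parity (s ++ t) =
  desusp_parity s (+) (odd (size t) && xorall s) (+) desusp_parity t.
Proof.
elim: s => [|b s IH] /=; first by rewrite big_nil andbF.
rewrite IH big_cons size_cat oddD.
by case: b; case: (odd _); case: (odd _); case: (xorall s);
  case: (desusp_parity s); case: (desusp_parity t).
Qed.

Lemma multilinearZ (U M : lmodType K) (f : seq U -> M) s1 s2 c u :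
  multilinear f -> f (s1 ++ (c *: u) :: s2) = c *: f (s1 ++ u :: s2).
Proof.
move=> [_ hf]; have lf : linear (fun z => f (s1 ++ z :: s2)).
  by move=> d x y; exact: hf.
exact: (linfZ c u lf).
Qed.

Lemma multilinear_prodZ (U M : lmodType K) (g : seq U -> M) (T : Type)
    (c : T -> K) (u : T -> U) (s : seq T) : multilinear g ->
  g [seq c x *: u x | x <- s] = (\prod_(x <- s) c x) *: g [seq u x | x <- s].
Proof.
move=> mg; rewrite -[map _ s]cat0s -[in RHS](cat0s (map u s)).
elim: s [::] => [|x s IH] s0 /=; first by rewrite big_nil scale1r.
by rewrite multilinearZ // -cat_rcons IH cat_rcons scalerA big_cons.
Qed.

Lemma multilinear_alternate V (M : lmodType K) (f : seq V -> M)
    (l : seq (deg n * V)) : multilinear f -> homlist l ->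
  f (alternate 0 [seq x.2 | x <- l]) =
    (-1) ^+ desusp_parity [seq par1 x.1 | x <- l] *: f [seq x.2 | x <- l].
Proof.
move=> hf; rewrite -[alternate _ _]cat0s -[X in _ = _ *: f X]cat0s.
elim: l [::] => [|[b v] l IH] s hl /=; first by rewrite scale1r.
have hv : ghom b v by apply: (hl (b, v)); rewrite inE eqxx.
rewrite (ksign_hom _ hv) multilinearZ // -cat_rcons IH; last first.
  by move=> x xl; apply: hl; rewrite inE xl orbT.
rewrite cat_rcons scalerA addn0 /dsign sign_par par_dot_e1 -signr_addb.
by rewrite !size_map.
Qed.

Lemma ghom_desusp V (b : deg n) (v : V) : ghom b v -> @ghom K n (desusp V) (b - e1) v.
Proof. by rewrite /ghom /= subrK. Qed.

Lemma ghom_up V (b : deg n) (v : V) : @ghom K n (desusp V) b v -> ghom (b + e1) v.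
Proof. by []. Qed.

Lemma homlist_desusp V (l : seq (deg n * V)) : homlist l ->
  @homlist K n (desusp V) [seq (x.1 - e1, x.2) | x <- l].
Proof. by move=> hl x /mapP[y yl ->]; apply: ghom_desusp; exact: hl. Qed.

End Desuspension.
Section Components.
Variables (K : fieldType) (n : nat).
Section Maps.
Variables V V' : gspace K n.
Implicit Type F : tspace (desusp V) -> tspace (desusp V').

Definition corestr_word F (w : seq V) : V' :=
  corestr (F (tens (w : seq (desusp V)))).

Lemma componentsE F w : components F w = corestr_word F (alternate 0 w).
Proof. by rewrite /components down_tensorE. Qed.

Lemma corestr_word_multilinear F : linear F -> multilinear (corestr_word F).
Proof.
move=> lF; have lc := linear_comp lF (@corestr_linear K (desusp V')).
exact: multilinear_comp (tens_multilinear (desusp V)) lc.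
Qed.

Lemma components_multilinear F : linear F -> multilinear (components F).
Proof.
move=> lF; have := alternate_multilinear 0 (corestr_word_multilinear lF).
by congr multilinear; apply/funext => w; rewrite componentsE.
Qed.

Lemma components_hom F (l : seq (deg n * V)) : linear F -> homlist l ->
  components F [seq x.2 | x <- l] =
  (-1) ^+ desusp_parity [seq par1 x.1 | x <- l] *:
    corestr_word F [seq x.2 | x <- l].
Proof.
move=> lF hl; rewrite componentsE multilinear_alternate //.
exact: corestr_word_multilinear.
Qed.

Lemma corestr_word_weight F b (l : seq (deg n * V)) : has_weight b F ->
  homlist l ->
  ghom (\sum_(x <- l) x.1 - e1 *+ size l + b + e1)
    (corestr_word F [seq x.2 | x <- l]).
Proof.
move=> wF hl; apply: ghom_up; rewrite -[_ + b]addr0; apply: corestr_weight.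
apply: wF; have := ghom_tens (homlist_desusp hl).
by rewrite big_map sumrB /= big_const_seq count_predT iter_addr_0 -map_comp.
Qed.

Lemma components_weight F b (l : seq (deg n * V)) : linear F -> has_weight b F ->
  homlist l ->
  ghom (\sum_(x <- l) x.1 - e1 *+ size l + b + e1)
    (components F [seq x.2 | x <- l]).
Proof.
by move=> lF wF hl; rewrite components_hom //; apply/ghomZ/corestr_word_weight.
Qed.

Lemma components_sequence F : cohomomorphism F -> component_sequence (components F).
Proof.
move=> [lF wF _]; split; first exact: components_multilinear.
move=> p a v p0 hv; pose l := [seq (a i, v i) | i <- enum 'I_p].
have hl : homlist l by exact: homlist_indexed.
have := components_weight lF wF hl; rewrite -map_comp addr0 big_map size_map.
rewrite big_enum /= -cardE card_ord; congr ghom.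
by rewrite -addrA; congr (_ + _); rewrite mulrzBr addrC.
Qed.

Lemma components_inj F G : cohomomorphism F -> cohomomorphism G ->
  components F = components G -> F = G.
Proof.
move=> hF hG E; apply/funext; apply: cohomomorphism_eq => // x.
have [[lF _ _] [lG _ _]] := (hF, hG); have lc := @corestr_linear K (desusp V').
apply: (univ_ind (adm := @multilinear K (desusp V))
  (P := fun x => corestr (F x) = corestr (G x)) _ _ _ x) => [|c y z hy hz|w].
- by rewrite (linf0 lF) (linf0 lG).
- by rewrite lF lG !lc hy hz.
have := congr1 (fun f => f (alternate 0 (w : seq V))) E.
by rewrite !componentsE !alternateK.
Qed.

(** [alternate] is an involution, so composing [f] with it gives multilinear maps
    of weight 0 on the desuspension, which are the corestrictions of [cofree]. *)
Lemma components_surj (f : seq V -> V') : component_sequence f ->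
  exists2 F, cohomomorphism F & components F = f.
Proof.
move=> [mf wf].
have mg : @multilinear K (desusp V) (desusp V') (fun w => f (alternate 0 (w : seq V))).
  exact: (alternate_multilinear 0 mf).
pose g (x : tspace (desusp V)) : desusp V' :=
  ulift (fun w => f (alternate 0 (w : seq V)) : desusp V') x.
have lg : linear g by exact: ulift_linear mg.
have gE w : g (tens w) = f (alternate 0 (w : seq V)) by exact: ulift_gen mg.
have wg : has_weight 0 g.
  apply: has_weight_words => // l hl; rewrite addr0 gE.
  pose l' : seq (deg n * V) := [seq (x.1 + e1, x.2) | x <- l].
  have hl' : homlist l' by move=> x /mapP[y yl ->]; apply: (hl y yl).
  have -> : [seq x.2 | x <- l] = [seq x.2 | x <- l'] by rewrite -map_comp.
  rewrite multilinear_alternate //; apply: ghomZ.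
  have [p [a [w [hw Ew Ea]]]] := homlist_word hl'.
  have pE : p = size l by have := congr1 size Ew; rewrite !size_map -cardE cardsT card_ord.
  have [p0|p0] := posnP p.
    rewrite Ew /select; case: (enum _) => [|i s]; last by have := ltn_ord i; rewrite {2}p0.
    by rewrite mf.1; exact: gproj0.
  have := wf p a w p0 hw; rewrite Ew /select enum_setT -enumT.
  rewrite /ghom /=; congr (gproj V' _ _ = _); rewrite /sdeg in Ea.
  rewrite (eq_bigl (fun i => i \in [set: 'I_p]%SET)) => [|i]; last by rewrite inE.
  rewrite -Ea big_map big_split /= big_const_seq count_predT iter_addr_0 -pE.
  rewrite -addrA; congr (_ + _).
  by rewrite mulrzBr mulr1z -pmulrn addrCA subrr addr0.
exists (cofree g); first exact: cofree_cohomomorphism.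
apply/funext => w; rewrite componentsE /corestr_word.
by rewrite (corestr_cofreeE lg) gE alternateK.
Qed.

End Maps.
End Components.

(** * Comparison of signs *)

Section Decalage.
Variables (K : fieldType) (n p : nat) (a : 'I_p -> deg n).
Implicit Types (A B : {set 'I_p}) (s : seq 'I_p).

Let par_a i : bool := par1 (a i).
Definition desusp_deg (i : 'I_p) : deg n := a i - e1.

Lemma dsign_desusp i j : dsign K (desusp_deg i) (desusp_deg j) =
  - 1 * dsign K (a i) (a j) * (-1) ^+ (par_a i (+) par_a j).
Proof.
rewrite /dsign !sign_par /desusp_deg dotDl !dotNl ![dot _ (_ - _)]dotC !dotDl !dotNl.
rewrite [dot (a j) (a i)]dotC [dot (a j) e1]dotC !dot_e1.
rewrite !(parD, parN) -!/(par1 _) par1_e1 -/(par_a i) -/(par_a j).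
set x := par (dot _ _).
by case: x; case: (par_a i); case: (par_a j); rewrite /= ?(expr0, expr1); ring.
Qed.

(** In [desusp_parity] every letter counts once for each letter to its right, so
    exchanging two neighbours [i] and [j] changes the exponent by the sum of
    their parities.  This is the contribution of an inversion to the difference
    between the exponents of the Koszul sign in the shifted degrees and of the
    signature times the Koszul sign in the original ones. *)
Lemma koszul_desusp A s : perm_eq s (enum A) ->
  koszul K desusp_deg s * (-1) ^+ desusp_parity [seq par_a i | i <- s] =
  signature K s * koszul K a s *
    (-1) ^+ desusp_parity [seq par_a i | i <- enum A].
Proof.
pose inv s := \big[addb/false]_(x <- inversions s) (par_a x.1 (+) par_a x.2).
have kE t : koszul K desusp_deg t = signature K t * koszul K a t * (-1) ^+ inv t.
  rewrite /koszul /signature /inv; elim: (inversions t) => [|x r IH].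
    by rewrite !big_nil !mul1r.
  rewrite !big_cons IH dsign_desusp exprS !signr_addb; ring.
(* The exponent for the sorted rearrangement of [t], written without mention of
   the order of the letters in [t]. *)
pose cnt (t : seq 'I_p) :=
  \big[addb/false]_(i <- t) \big[addb/false]_(j <- t | (i < j)%N) par_a i.
have cntE t : uniq t -> inv t (+) desusp_parity [seq par_a i | i <- t] = cnt t.
  rewrite /inv /cnt; elim: t => [|i t IH] /=; first by rewrite !big_nil.
  case/andP=> it /IH; rewrite !big_cons big_cat /= ltnn size_map big_map big_filter.
  set X := \big[addb/false]_(x <- inversions t) _; set Y := desusp_parity _.
  move=> E.
  have -> : \big[addb/false]_(k <- t) \big[addb/false]_(j <- i :: t | (k < j)%N) par_a k =
    \big[addb/false]_(k <- t | (k < i)%N) par_a k (+) (X (+) Y).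
    rewrite E [X in _ = X (+) _]big_mkcond -big_split; apply: eq_bigr => k _ /=.
    by rewrite big_cons; case: ifP.
  have -> : odd (size t) && par_a i = \big[addb/false]_(k <- t | (k < i)%N) par_a i (+)
     \big[addb/false]_(k <- t | (i < k)%N) par_a i.
    rewrite [X in _ = X (+) _]big_mkcond [X in _ = _ (+) X]big_mkcond -big_split /=.
    elim: t it {IH X Y E} => [|k t IH] /=; first by rewrite big_nil.
    rewrite inE negb_or big_cons => /andP[ik /IH <-].
    by case: ltngtP ik => [||/val_inj ->]; rewrite ?eqxx //; case: (odd _); case: (par_a i).
  rewrite big_split /=; set x1 := \big[addb/false]_(_ <- t | _) par_a i.
  set x2 := \big[addb/false]_(_ <- t | _) _; set x3 := \big[addb/false]_(_ <- t | _) _.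
  by case: x1; case: x2; case: x3; case: (X); case: (Y).
move=> sA; have us : uniq s by rewrite (perm_uniq sA) enum_uniq.
have E : inv s (+) desusp_parity [seq par_a i | i <- s] =
    desusp_parity [seq par_a i | i <- enum A].
  rewrite cntE //; transitivity (cnt (enum A)).
    rewrite /cnt (perm_big _ sA); apply: eq_bigr => i _; exact: perm_big.
  rewrite -cntE ?enum_uniq //; suff -> : inv (enum A) = false by [].
  rewrite /inv (_ : inversions _ = [::]) ?big_nil //.
  have := sorted_enum A; rewrite sorted_pairwise; last exact: ltI_trans.
  elim: (enum A) => //= i t IH /andP[/allP h /IH ->]; rewrite cats0.
  rewrite (eq_in_filter (a2 := pred0)) ?filter_pred0 // => j jt /=.
  by apply/negbTE; rewrite -leqNgt ltnW //; exact: h.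
by rewrite kE -mulrA -signr_addb E.
Qed.

(** The signature is the Koszul sign of letters of odd degree, whence its
    multiplicativity properties. *)
Lemma signature_koszul s : signature K s = koszul K (fun=> e1 : deg n) s.
Proof.
rewrite /signature /koszul; elim: (inversions s) => [|x r IH].
  by rewrite big_nil.
by rewrite big_cons -IH exprS /dsign dot_e1 mxE.
Qed.

Lemma signature_swap A B : [disjoint A & B] ->
  signature K (enum B ++ enum A) =
  signature K (enum A ++ enum B) * (-1) ^+ (odd #|A| && odd #|B|).
Proof.
move=> dAB; rewrite !signature_koszul !koszul_enum2 -ukoszulC //; congr (_ * _).
have E C : sdeg (fun=> e1 : deg n) C = e1 *+ #|C| by rewrite /sdeg big_const iter_addr_0.
by rewrite !E /dsign sign_par par_dot_e1 par1Mn par1_e1 andbT.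
Qed.

End Decalage.

Section Omega.
Variables (n p : nat) (a : 'I_p -> deg n).
Let par_a i : bool := par1 (a i).

Lemma par_sum (I : Type) (r : seq I) (P : pred I) (F : I -> int) :
  par (\sum_(i <- r | P i) F i) = \big[addb/false]_(i <- r | P i) par (F i).
Proof. by apply: (big_morph par) => // x y; exact: parD. Qed.

Lemma par_nat (k : nat) : par k = odd k.
Proof. by []. Qed.

Lemma odd_sum (I : Type) (r : seq I) (P : pred I) (F : I -> nat) :
  odd (\sum_(i <- r | P i) F i) = \big[addb/false]_(i <- r | P i) odd (F i).
Proof. by apply: (big_morph odd) => // x y; exact: oddD. Qed.

(** The condition [0 < r] of [omega] disappears because the inner sum is empty for
    [r = 0]. *)
Lemma par_omega s (I : s.-tuple {set 'I_p}) : par (omega a I) =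
  odd (s * s.-1)./2 (+) \big[addb/false]_(r < s) (odd (s - r.+1) && odd #|tnth I r|)
  (+) \big[addb/false]_(r < s) (~~ odd #|tnth I r| &&
        \big[addb/false]_(q < s | (q < r)%N) par1 (sdeg a (tnth I q))).
Proof.
rewrite /omega parD par_nat oddD odd_sum par_sum; congr (_ (+) _ (+) _).
  by apply: eq_bigr => r _; rewrite oddM.
rewrite big_mkcond; apply: eq_bigr => r _ /=.
case: posnP => [r0|_]; first by rewrite [X in _ && X]big_pred0 ?andbF // => q; rewrite r0.
by rewrite par_dot_e1 par1_sum.
Qed.

Lemma par_omega_cons s (A : {set 'I_p}) (I : s.-tuple {set 'I_p}) :
  par (omega a [tuple of A :: I]) = par (omega a I) (+)
    (odd s && ~~ odd #|A|) (+)
    (par1 (sdeg a A) && (odd s (+) \big[addb/false]_(B <- I) odd #|B|)).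
Proof.
rewrite !par_omega.
have tE (r : 'I_s) : tnth [tuple of A :: I] (lift ord0 r) = tnth I r by rewrite tnthS.
have -> : odd (s.+1 * s.+1.-1)./2 = odd (s * s.-1)./2 (+) odd s.
  rewrite /= (_ : (s.+1 * s = s * s.-1 + s.*2)%N); last by case: s {I tE} => //= s; lia.
  by rewrite halfD odd_double andbF add0n doubleK oddD.
have -> : \big[addb/false]_(r < s.+1) (odd (s.+1 - r.+1) && odd #|tnth [tuple of A :: I] r|) =
    (odd s && odd #|A|) (+) \big[addb/false]_(r < s) (odd (s - r.+1) && odd #|tnth I r|).
  rewrite big_ord_recl subSS subn0 /=; congr (_ (+) _).
  by apply: eq_bigr => r _; rewrite tE /bump /= add1n subSS.
rewrite big_ord_recl [X in _ (+) (X (+) _)](_ : _ = false); last first.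
  by rewrite [X in _ && X]big_pred0 ?andbF.
have -> : \big[addb/false]_(r < s) (~~ odd #|tnth [tuple of A :: I] (lift ord0 r)| &&
      \big[addb/false]_(q < s.+1 | (q < lift ord0 r)%N) par1 (sdeg a (tnth [tuple of A :: I] q))) =
    (par1 (sdeg a A) && (odd s (+) \big[addb/false]_(B <- I) odd #|B|)) (+)
    \big[addb/false]_(r < s) (~~ odd #|tnth I r| &&
        \big[addb/false]_(q < s | (q < r)%N) par1 (sdeg a (tnth I q))).
  have -> : odd s (+) \big[addb/false]_(B <- I) odd #|B| =
      \big[addb/false]_(r < s) ~~ odd #|tnth I r|.
    rewrite big_tuple -[in odd s](card_ord s) -sum1_card odd_sum -big_split.
    by apply: eq_bigr => r _.
  rewrite (big_morph (andb (par1 (sdeg a A))) (andb_addr _) (andbF _)) -big_split.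
  apply: eq_bigr => r _ /=; rewrite tE big_mkcond big_ord_recl /=.
  rewrite [X in _ = _ (+) (_ && X)]big_mkcond andb_addr andbC; congr (_ (+) (_ && _)).
  by apply: eq_bigr => q _; rewrite tE.
set x1 := odd _./2; set x2 := \big[addb/false]_(r < s) _; set x3 := \big[addb/false]_(r < s) _.
rewrite addFb; set y := _ && (_ (+) _).
by case: x1; case: x2; case: x3; case: y; case: (odd s); case: (odd #|A|).
Qed.

Lemma xorall_enum (A : {set 'I_p}) :
  xorall [seq par_a i | i <- enum A] = par1 (sdeg a A).
Proof. by rewrite big_map big_enum par1_sum. Qed.

(** [omega] collects the desuspension signs of the inner maps [f], of the outer
    map [pi'], whose arguments have degrees of parity
    [par1 (sdeg a A) (+) ~~ odd #|A|], and of the unshuffled word. *)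
Lemma omega_blocks s (I : s.-tuple {set 'I_p}) :
  par (omega a I) =
  desusp_parity [seq par1 (sdeg a A) (+) ~~ odd #|A| | A : {set 'I_p} <- I] (+)
  \big[addb/false]_(A <- I) desusp_parity [seq par_a i | i <- enum A] (+)
  desusp_parity [seq par_a i | i <- flatten [seq enum A | A : {set 'I_p} <- I]].
Proof.
elim: s I => [|s IH] I.
  by rewrite tuple0 par_omega /= !big_nil !big_ord0.
case/tupleP: I => A I; rewrite par_omega_cons IH /= map_cat desusp_parity_cat.
rewrite xorall_enum big_cons size_map size_tuple size_map size_flatten.
have -> : odd (sumn (shape [seq enum B | B : {set 'I_p} <- I])) =
    \big[addb/false]_(B <- I) odd #|B|.
  rewrite sumnE /shape -map_comp big_map odd_sum; apply: eq_bigr => B _ /=.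
  by rewrite -cardE.
set x1 := desusp_parity _; set x2 := \big[addb/false]_(j <- I) _.
set x3 := desusp_parity _; set x4 := desusp_parity _.
set x5 := par1 _; set x6 := \big[addb/false]_(j <- I) _.
case: (odd s); case: x1; case: x2; case: x3; case: x4; case: x5; case: x6;
  by case: (odd #|A|).
Qed.

(** [lambda] collects the sign [(-1)^<e_1, V_I>] of the coderivation in shifted
    degrees, the desuspension signs of the whole word, of [pi] and of [f], the
    passage of [koszul_desusp] from the prefix to its unshuffle, and the
    transposition of [I] and [J] in the signature. *)
Lemma lambda_parity (j : 'I_p) (I : {set 'I_p}) : I \subset prefix_set p j ->
  let J := prefix_set p j :\: I in
  par (lambda a I J) =
    (odd #|I| && odd #|J|) (+) par1 (sdeg a I) (+) odd #|I| (+)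
    desusp_parity [seq par_a i | i <- enum [set: 'I_p]%SET] (+)
    desusp_parity [seq par_a i | i <- enum (prefix_set p j)] (+)
    desusp_parity [seq par_a i | i <- enum I ++ enum J] (+)
    desusp_parity [seq par_a i | i <- rcons (enum J) j] (+)
    desusp_parity ([seq par_a i | i <- enum I] ++
      (par1 (sdeg a J) (+) par_a j (+) ~~ odd #|J|) ::
      [seq par_a i | i <- enum (between p j p)]).
Proof.
move=> sI J; have IJ : [disjoint I & J].
  by rewrite -setI_eq0 setIC /J setIDAC setDIl setDv setI0.
have PE : prefix_set p j = I :|: J by rewrite -[LHS](setID _ I) (setIidPr sI).
have TE : enum [set: 'I_p]%SET = enum (prefix_set p j) ++ j :: enum (between p j p).
  rewrite -enum_suffix; apply: enum_sortedE => [|i]; last first.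
    by rewrite mem_cat !mem_enum !inE orbN.
  rewrite sorted_pairwise; last exact: ltI_trans.
  rewrite pairwise_cat -!(sorted_pairwise (@ltI_trans p)) !sorted_enum !andbT.
  apply/allrelP => i k; rewrite !mem_enum !inE -leqNgt; exact: leq_trans.
have cT : p = (#|I| + #|J| + #|between p j p|.+1)%N.
  have := congr1 size TE; rewrite -cardE cardsT card_ord size_cat /= -!cardE PE.
  by rewrite cardsU (disjoint_setI0 IJ) cards0 subn0.
rewrite /lambda par_dot_e1 par1D par1Mn par1_e1 andbT TE !map_cat map_rcons -cats1.
rewrite !desusp_parity_cat /= !size_map !xorall_enum -!cardE.
have -> : par1 (sdeg a (prefix_set p j)) = par1 (sdeg a I) (+) par1 (sdeg a J).
  rewrite -par1D; congr par1.
  by rewrite /sdeg (big_setID I) /= (setIidPr sI).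
have := congr1 odd cT; rewrite !oddD oddS => ->.
set x1 := desusp_parity _; set x2 := desusp_parity _.
set x3 := desusp_parity _; set x4 := desusp_parity _.
set y1 := par1 (sdeg a I); set y2 := par1 (sdeg a J).
case: (odd #|I|); case: (odd #|J|); case: (odd #|_|); case: y1; case: y2;
  case: (par_a j); case: x1; case: x2; case: x3; by case: x4.
Qed.
End Omega.

(** * The morphism condition on components *)

Lemma signr_xor (K : fieldType) (T : Type) (s : seq T) (b : T -> bool) :
  (-1) ^+ (\big[addb/false]_(x <- s) b x) = \prod_(x <- s) (-1) ^+ b x :> K.
Proof. by apply: (big_morph (fun b : bool => (-1) ^+ b)) => // x y; exact: signr_addb. Qed.

Section Condition.
Variables (K : fieldType) (n : nat) (V V' : gspace K n).
Variables (Q : tspace (desusp V) -> tspace (desusp V))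
  (Q' : tspace (desusp V') -> tspace (desusp V'))
  (F : tspace (desusp V) -> tspace (desusp V')).
Hypotheses (hQ : coderivation e1 Q) (hQ' : coderivation e1 Q')
  (hF : cohomomorphism F).
Variables (p : nat) (a : 'I_p -> deg n) (v : 'I_p -> V).
Hypothesis hv : forall i, ghom (a i) (v i).

Let par_a i := par1 (a i).
Let w : 'I_p -> desusp V := v.
Let total_sign : K :=
  (-1) ^+ desusp_parity [seq par_a i | i <- enum [set: 'I_p]%SET].

Let hw i : ghom (desusp_deg a i) (w i).
Proof. exact: ghom_desusp. Qed.

Lemma components_select (G : tspace (desusp V) -> tspace (desusp V')) s :
  linear G ->
  components G [seq v i | i <- s] =
    (-1) ^+ desusp_parity [seq par_a i | i <- s] *:
    corestr (G (tens [seq w i | i <- s])).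
Proof.
move=> lG; have := components_hom lG (homlist_indexed (s := s) hv).
by rewrite -!map_comp.
Qed.

(** The left-hand side of the identity is, up to the desuspension sign of the
    whole word, the corestriction of [Q' \o F]: expand [F] by
    [cohomomorphism_blocks], rewrite the corestrictions through the components,
    and compare the signs by [omega_blocks] and [koszul_desusp]. *)
Lemma left_hand_side :
  \sum_(1 <= s < p.+1)
    \sum_(I : s.-tuple {set 'I_p} | ordered_unshuffles I)
      ((-1) ^ omega a I *
       signature K (flatten [seq enum A | A : {set 'I_p} <- I]) *
       koszul K a (flatten [seq enum A | A : {set 'I_p} <- I])) *:
      components Q' [seq components F (select v A) | A : {set 'I_p} <- I] =
  total_sign *: corestr (Q' (F (word w [set: 'I_p]%SET))).
Proof.
have [lF wF _] := hF; have [lQ' wQ' _] := hQ'.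
have lc := linear_comp lQ' (@corestr_linear K (desusp V')).
rewrite (cohomomorphism_blocks hw hF (N := p)); last by rewrite cardsT card_ord.
rewrite (linf_sum _ _ _ lc) scaler_sumr; apply: eq_bigr => s _.
rewrite (linf_sum _ _ _ lc) scaler_sumr; apply: eq_bigr => I hI.
have {}hI : ordered_blocks [set: 'I_p]%SET I by [].
rewrite (linfZ _ _ lc) scalerA.
pose f A := components F (select v A).
pose b (A : {set 'I_p}) : deg n := \sum_(i <- enum A) a i - e1 *+ #|A| + 0 + e1.
have hf : homlist [seq (b A, f A) | A : {set 'I_p} <- I].
  move=> x /mapP[A _ ->] /=.
  have := components_weight lF wF (homlist_indexed (s := enum A) hv).
  by rewrite big_map size_map -cardE -map_comp.
have -> : [seq components F (select v A) | A : {set 'I_p} <- I] =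
  [seq x.2 | x <- [seq (b A, f A) | A : {set 'I_p} <- I]] by rewrite -map_comp.
rewrite components_hom // -!map_comp.
rewrite (eq_map (g := fun A : {set 'I_p} => par1 (sdeg a A) (+) ~~ odd #|A|)); last first.
  move=> A /=; rewrite /b !par1D par1N par1Mn par1_e1 par1_0 andbT addbF big_enum.
  by rewrite -addbA addbT.
rewrite (eq_map (g := fun A : {set 'I_p} => (-1) ^+ desusp_parity [seq par_a i | i <- enum A] *:
    corestr (F (word w A)) : V')); last first.
  by move=> A /=; rewrite /f components_select.
rewrite (multilinear_prodZ _ _ _ (corestr_word_multilinear lQ')) -signr_xor !scalerA.
congr (_ *: _).
rewrite sign_par omega_blocks.
have E := koszul_desusp K a (flatten_blocks hI).
have ss (x : bool) : (-1) ^+ x * (-1) ^+ x = 1 :> K by rewrite -signr_addb addbb.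
move: E; set x3 := desusp_parity _; set k' := koszul _ _ _.
set sg := signature _ _; set k := koszul _ _ _ => E.
have {E} -> : k' = sg * k * total_sign * (-1) ^+ x3.
  by rewrite -E -mulrA ss mulr1.
set x1 := desusp_parity _; set x2 := \big[addb/false]_(A <- I) _.
rewrite !signr_addb.
transitivity (((-1) ^+ x1 * (-1) ^+ x1) * ((-1) ^+ x2 * (-1) ^+ x2) *
  (sg * k * (-1) ^+ x3)); first by ring.
transitivity ((total_sign * total_sign) * (sg * k * (-1) ^+ x3)); last by ring.
by rewrite !ss !mul1r.
Qed.

(** Likewise for the right-hand side and [F \o Q], with [coderivation_prefix] and
    [lambda_parity]; the common sign is the same as in [left_hand_side]. *)
Lemma right_hand_side :
  \sum_(I : {set 'I_p}) \sum_(J : {set 'I_p})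
    \sum_(L : {set 'I_p} | split_unshuffles I J L)
      ((-1) ^ lambda a I J *
       signature K (enum J ++ enum I) *
       koszul K a (enum I ++ enum J)) *:
      (if enum L is k :: L' then
         components F (select v I ++ components Q (rcons (select v J) (v k)) ::
                [seq v i | i <- L'])
       else 0) =
  total_sign *: corestr (F (Q (word w [set: 'I_p]%SET))).
Proof.
have [lF wF _] := hF; have [lQ wQ _] := hQ.
have lc := linear_comp lF (@corestr_linear K (desusp V')).
rewrite (sum_split_unshuffles (fun I J L => ((-1) ^ lambda a I J *
       signature K (enum J ++ enum I) *
       koszul K a (enum I ++ enum J)) *:
      (if enum L is k :: L' then
         components F (select v I ++ components Q (rcons (select v J) (v k)) ::
                [seq v i | i <- L'])
       else 0))).
have -> : [set: 'I_p]%SET = prefix_set p p by apply/setP => i; rewrite !inE ltn_ord.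
rewrite (coderivation_prefix hw hQ (leqnn p)) (linf_sum _ _ _ lc) scaler_sumr.
apply: eq_big => [j|j _]; first by rewrite ltn_ord.
rewrite (linf_sum _ _ _ lc) scaler_sumr; apply: eq_bigr => I sI.
rewrite (linfZ _ _ lc) scalerA enum_suffix.
set J := prefix_set p j :\: I.
have IJ : [disjoint I & J].
  by rewrite -setI_eq0 setIC /J setIDAC setDIl setDv setI0.
have enJ : enum (j |: J) = rcons (enum J) j.
  have jJ : j \notin J by rewrite !inE ltnn andbF.
  apply: enum_sortedE => [|i]; last by rewrite mem_rcons !inE mem_enum !inE.
  have := sorted_enum J; case E : (enum J) => [//|i s] /= js.
  rewrite rcons_path js /=; have : last i s \in J by rewrite -mem_enum E mem_last.
  by rewrite !inE => /andP[].
have eQ : components Q (rcons (select v J) (v j)) =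
    (-1) ^+ desusp_parity [seq par_a i | i <- rcons (enum J) j] *:
    corestr (Q (word w (j |: J))).
  rewrite /select -map_rcons -enJ.
  have := components_hom lQ (homlist_indexed (s := enum (j |: J)) hv).
  by rewrite -!map_comp.
pose b : deg n := \sum_(i <- enum (j |: J)) a i - e1 *+ #|j |: J| + e1 + e1.
have hb : ghom b (corestr (Q (word w (j |: J))) : V).
  have := corestr_word_weight wQ (homlist_indexed (s := enum (j |: J)) hv).
  by rewrite big_map size_map -cardE -map_comp.
pose l := [seq (a i, v i) | i <- enum I] ++
  (b, corestr (Q (word w (j |: J))) : V) :: [seq (a i, v i) | i <- enum (between p j p)].
have hl : homlist l.
  move=> x; rewrite mem_cat inE => /orP[|/orP[/eqP -> //|]]; exact: homlist_indexed.
rewrite eQ multilinearZ; last exact: components_multilinear.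
have -> : select v I ++ corestr (Q (word w (j |: J))) ::
    [seq v i | i <- enum (between p j p)] = [seq x.2 | x <- l].
  by rewrite map_cat /= -!map_comp.
rewrite components_hom // !scalerA.
congr (_ *: _).
have -> : [seq par1 x.1 | x <- l] = [seq par_a i | i <- enum I] ++
   (par1 (sdeg a J) (+) par_a j (+) ~~ odd #|J|) :: [seq par_a i | i <- enum (between p j p)].
  rewrite map_cat /= -!map_comp; congr (_ ++ _ :: _).
  rewrite /b !par1D par1N par1Mn par1_e1 enJ -cats1 big_cat big_seq1 big_enum.
  rewrite cardE enJ size_rcons -cardE par1D /= andbT.
  by rewrite -[LHS]addbA addbF.
have pIJ : perm_eq (enum I ++ enum J) (enum (prefix_set p j)).
  apply: uniq_perm; rewrite ?enum_uniq //.
    rewrite cat_uniq !enum_uniq andbT /=; apply/hasPn => i.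
    by rewrite !mem_enum !inE => /andP[].
  move=> i; rewrite mem_cat !mem_enum !inE.
  by case iI: (i \in I) => //=; have := subsetP sI i iI; rewrite inE => ->.
have -> : dsign K e1 (sdeg (desusp_deg a) I) = (-1) ^+ (par1 (sdeg a I) (+) odd #|I|).
  rewrite /dsign sign_par dot_e1 -/(par1 _) /sdeg /desusp_deg sumrB par1D par1N.
  by rewrite big_const iter_addr_0 par1Mn par1_e1 andbT.
have ss (x : bool) : (-1) ^+ x * (-1) ^+ x = 1 :> K by rewrite -signr_addb addbb.
have := koszul_desusp K a pIJ; rewrite koszul_enum2 -/par_a.
rewrite (signature_swap K n IJ) sign_par (lambda_parity a sI) -/J -/par_a -/total_sign.
set sg := signature _ _; set k := koszul _ _ _; set k' := ukoszul _ _ _ _.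
set x0 := desusp_parity [seq _ | i <- enum (prefix_set p j)].
set x1 := desusp_parity [seq _ | i <- enum I ++ enum J].
set x2 := desusp_parity [seq _ | i <- rcons _ _].
set x3 := desusp_parity (_ ++ _).
move=> E; have {E} -> : k' = sg * k * (-1) ^+ x0 * (-1) ^+ x1.
  by rewrite -E -mulrA ss mulr1.
rewrite !signr_addb -/total_sign; set y := (-1) ^+ (_ && _).
transitivity (y * y * ((-1) ^+ x2 * (-1) ^+ x2) * ((-1) ^+ x3 * (-1) ^+ x3) *
  (total_sign * (sg * k * (-1) ^+ x0 * (-1) ^+ x1 *
   ((-1) ^+ par1 (sdeg a I) * (-1) ^+ odd #|I|)))); first by ring.
by rewrite !ss !mul1r.
Qed.

End Condition.

Local Open Scope classical_set_scope.
Local Open Scope ring_scope.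

Theorem proposition8 (K : fieldType) (charK : [pchar K] =i pred0) (n : nat)
    (V V' : gspace K n)
    (Q : tspace (desusp V) -> tspace (desusp V))
    (Q' : tspace (desusp V') -> tspace (desusp V'))
    (hQ : lod_infty_algebra Q) (hQ' : lod_infty_algebra Q') :
  set_bij
    [set F : tspace (desusp V) -> tspace (desusp V') | cohomomorphism F]
    [set f : seq V -> V' | component_sequence f]
    (@components K n V V')
  /\
  forall F : tspace (desusp V) -> tspace (desusp V'), cohomomorphism F ->
    let f := components F in
    let pi := components Q in
    let pi' := components Q' in
    lod_infty_morphism Q Q' F <->
    forall (p : nat) (a : 'I_p -> deg n) (v : 'I_p -> V),
      (0 < p)%N -> (forall i, ghom (a i) (v i)) ->
      \sum_(1 <= s < p.+1)
        \sum_(I : s.-tuple {set 'I_p} | ordered_unshuffles I)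
          ((-1) ^ omega a I *
           signature K (flatten [seq enum A | A : {set 'I_p} <- I]) *
           koszul K a (flatten [seq enum A | A : {set 'I_p} <- I])) *:
          pi' [seq f (select v A) | A : {set 'I_p} <- I]
      =
      \sum_(I : {set 'I_p}) \sum_(J : {set 'I_p})
        \sum_(L : {set 'I_p} | split_unshuffles I J L)
          ((-1) ^ lambda a I J *
           signature K (enum J ++ enum I) *
           koszul K a (enum I ++ enum J)) *:
          (if enum L is k :: L' then
             f (select v I ++ pi (rcons (select v J) (v k)) ::
                [seq v i | i <- L'])
           else 0).
Proof.
split.
  split=> [F hF|F G|f hf].
  - exact: components_sequence.
  - by move=> /set_mem hF /set_mem hG; exact: components_inj.
  - by have [F hF <-] := components_surj hf; exists F.
move=> F hF f pi pi'; have [[hQc _] [hQc' _]] := (hQ, hQ').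
split=> [[_ hm] p a v _ hv|h].
  by rewrite (left_hand_side hQc' hF hv) hm (right_hand_side hQc hF hv).
split=> //; apply: (intertwine_corestr hQc hQc' hF) => x.
have [[[lF _ _] [lQ _ _]] [lQ' _ _]] := (hF, hQc, hQc').
have lc := @corestr_linear K (desusp V').
elim/tspace_ind: x => [|c x y hx hy|p a w hw].
- by rewrite (linf0 lF) (linf0 lQ) (linf0 lQ') (linf0 lF).
- by rewrite lF lQ' lQ lF !lc hx hy.
have [p0|p0] := posnP p.
  have -> : [set: 'I_p]%SET = finset.set0.
    by apply/setP => i; have := ltn_ord i; rewrite {2}p0.
  by rewrite word0 (linf0 lF) (linf0 lQ) (linf0 lQ') (linf0 lF).
(* A letter of degree [a] in the desuspension has degree [a + e1] in [V]. *)
have hv i : ghom (a i + e1) (w i : V) := ghom_up (hw i).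
have := h p (fun i => a i + e1) w p0 hv.
rewrite (left_hand_side hQc' hF hv) (right_hand_side hQc hF hv).
set s := desusp_parity _ => /(congr1 (fun x => (-1) ^+ s *: x)).
by rewrite !scalerA -!signr_addb addbb !scale1r.
Qed.
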